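(* Let $(E_1,E_2)$ be a pair of complex Banach spaces having property (V), and let $B_1$ and $B_2$ be the open unit balls of $E_1$ and $E_2$. Let $f\colon B_1\to B_2$ be a holomorphic map such that at least one of the following holds: (1) $f(0)=0$, and $f'(0)$ is an isometry for the Carathéodory infinitesimal metric; or (2) $B_1$ and $B_2$ are homogeneous, and there exists $a\in B_1$ such that $f'(a)$ is an isometry for the Carathéodory infinitesimal metric. Then $f(B_1)$ is a closed complex direct submanifold of $B_2$, the map $f$ is a biholomorphism of $B_1$ onto $f(B_1)$, and there exists a holomorphic retraction of $B_2$ onto $f(B_1)$.
   Context: Property (V): a pair $(E_1,E_2)$ of complex Banach spaces has property (V) if for every (complex) linear isometry $L\colon E_1\to E_2$ (norm-preserving, not necessarily surjective) there exists a direct decomposition $E_2=L(E_1)\oplus F$ (with $F$ a closed complex linear subspace) such that the corresponding projection $\pi\colon E_2\to L(E_1)$, with kernel $F$, has operator norm $1$. Carathéodory infinitesimal metric: for a bounded domain $D$ in a complex Banach space $E$, $a\in D$ and $v\in E$, $E_D(a,v)=\sup\{|\varphi'(a)v| : \varphi\colon D\to\Delta \text{ holomorphic},\ \varphi(a)=0\}$, where $\Delta$ is the open unit disc in $\mathbb{C}$. For a holomorphic map $f\colon B_1\to B_2$ and $a\in B_1$, ''$f'(a)$ is an isometry for the Carathéodory infinitesimal metric'' means $E_{B_2}(f(a),f'(a)v)=E_{B_1}(a,v)$ for all $v\in E_1$; surjectivity of $f'(a)$ is not assumed. A domain is homogeneous if its group of biholomorphic automorphisms acts transitively on it. A closed complex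 direct submanifold $M$ of an open set $U\subseteq E_2$ is a relatively closed subset $M\subseteq U$ such that near each of its points there is a biholomorphic chart of $U$ taking $M$ to an open piece of a closed complemented complex linear subspace of $E_2$ (complemented meaning that it has a closed complementary subspace). A holomorphic retraction of $B_2$ onto $f(B_1)$ is a holomorphic map $r\colon B_2\to B_2$ with $r(B_2)=f(B_1)$ and $r(x)=x$ for all $x\in f(B_1)$. *)

(* Defs.v *)
From HB Require Import structures.
From mathcomp Require Import all_boot all_order all_algebra.
From mathcomp Require Import complex.
From mathcomp Require Import all_classical all_reals.
From mathcomp Require Import ereal topology normedtype derive.

Set Implicit Arguments.
Unset Strict Implicit.
Unset Printing Implicit Defensive.

Import Order.TTheory GRing.Theory Num.Theory.
Import numFieldNormedType.Exports.

Local Open Scope classical_set_scope.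
Local Open Scope ring_scope.
Local Open Scope complex_scope.

(* Complex Banach spaces are completeNormedModType R[i] for a realType R.
   Maps between subsets of Banach spaces are total functions of which only the
   values on the stated (open) domain matter. *)

(* The norm of a normedModType R[i] takes its values in R[i]: it is a real
   number >= 0 seen as a complex number, and rnorm is this real number. *)
Definition rnorm (R : realType) (E : normedModType R[i]) (x : E) : R :=
  complex.Re `|x|.

Definition unit_ball (R : realType) (E : normedModType R[i]) : set E :=
  [set x | `|x| < 1].

Definition operator_norm (R : realType) (E F : normedModType R[i])
    (T : E -> F) : \bar R :=
  ereal_sup [set (rnorm (T x))%:E | x in [set x | `|x| <= 1]].

Definition is_subspace (R : realType) (E : normedModType R[i]) (S : set E) :=
  S 0 /\ forall (c : R[i]) (x y : E), S x -> S y -> S (c *: x + y).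

Definition closed_subspace (R : realType) (E : normedModType R[i])
    (S : set E) :=
  is_subspace S /\ closed S.

Definition direct_decomposition (R : realType) (E : normedModType R[i])
    (S F : set E) :=
  S `&` F = [set 0] /\ forall x, exists s t, [/\ S s, F t & x = s + t].

Definition complemented_subspace (R : realType) (E : normedModType R[i])
    (S : set E) :=
  closed_subspace S /\
  exists F : set E, closed_subspace F /\ direct_decomposition S F.

Definition projection_onto_along (R : realType) (E : normedModType R[i])
    (S F : set E) (p : {linear E -> E}) :=
  [/\ forall x, S (p x), forall x, S x -> p x = x
    & [set x | p x = 0] = F].

Definition linear_isometry (R : realType) (E1 E2 : normedModType R[i])
    (L : {linear E1 -> E2}) :=
  forall x, `|L x| = `|x|.

Definition property_V (R : realType) (E1 E2 : completeNormedModType R[i]) :=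
  forall L : {linear E1 -> E2}, linear_isometry L ->
  exists (F : set E2) (p : {linear E2 -> E2}),
    [/\ closed_subspace F, direct_decomposition (range L) F,
        projection_onto_along (range L) F p & operator_norm p = 1%:E].

(* Frechet differentiability over the scalar field R[i] *)
Definition holomorphic_on (R : realType) (E F : normedModType R[i])
    (U : set E) (f : E -> F) :=
  open U /\ forall x, U x -> differentiable f x.

Definition biholomorphism (R : realType) (E F : normedModType R[i])
    (U : set E) (V : set F) (f : E -> F) (g : F -> E) :=
  [/\ holomorphic_on U f /\ holomorphic_on V g,
      f @` U `<=` V, g @` V `<=` U,
      forall x, U x -> g (f x) = x & forall y, V y -> f (g y) = y].

Definition homogeneous (R : realType) (E : normedModType R[i]) (D : set E) :=
  forall x y, D x -> D y ->
  exists f g : E -> E, biholomorphism D D f g /\ f x = y.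

Definition caratheodory (R : realType) (E : normedModType R[i])
    (D : set E) (a v : E) : \bar R :=
  ereal_sup [set (rnorm ('d phi a v))%:E | phi in
    [set phi : E -> R[i]^o |
       [/\ holomorphic_on D phi, phi @` D `<=` @unit_ball R R[i]^o
         & phi a = 0]]].

Definition caratheodory_isometry (R : realType) (E1 E2 : normedModType R[i])
    (D1 : set E1) (D2 : set E2) (f : E1 -> E2) (a : E1) :=
  forall v, caratheodory D2 (f a) ('d f a v) = caratheodory D1 a v.

(* phi : W -> W' is a biholomorphic chart of U, with inverse psi, taking
   M `&` W to the open piece S `&` W' of the subspace S *)
Definition submanifold_chart (R : realType) (E : normedModType R[i])
    (U M W W' S : set E) (phi psi : E -> E) :=
  [/\ W `<=` U, biholomorphism W W' phi psi,
      complemented_subspace S & phi @` (M `&` W) = S `&` W'].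

Definition closed_direct_submanifold (R : realType) (E : normedModType R[i])
    (U M : set E) :=
  [/\ open U, exists2 A : set E, closed A & M = U `&` A
    & forall x, M x -> exists (W W' S : set E) (phi psi : E -> E),
        submanifold_chart U M W W' S phi psi /\ W x].

(* Frechet differentiability at x of the restriction of g to a neighbourhood
   of x in the normed space S: only the values of g and of its derivative T on
   S matter. *)
Definition differentiable_along (R : realType) (E F : normedModType R[i])
    (S : set E) (g : E -> F) (x : E) :=
  exists T : E -> F,
    [/\ forall (c : R[i]) (u v : E), S u -> S v -> T (c *: u + v) = c *: T u + T v,
        {within S, continuous T}
      & forall e : R[i], 0 < e ->
          \forall y \near x, S y -> `|g y - g x - T (y - x)| <= e * `|y - x|].

(* Holomorphy of maps to and from M is read in the charts of M. *)
Definition biholomorphism_onto_submanifold (R : realType)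
    (E F : normedModType R[i]) (D : set E) (U M : set F) (f : E -> F) :=
  exists g : F -> E,
  [/\ f @` D = M,
      forall x, D x -> g (f x) = x,
      forall x, D x -> {for x, continuous f},
      forall (W W' S : set F) (phi psi : F -> F),
        submanifold_chart U M W W' S phi psi ->
        forall x, D x -> W (f x) -> differentiable (phi \o f) x
    & forall (W W' S : set F) (phi psi : F -> F),
        submanifold_chart U M W W' S phi psi ->
        forall y, (S `&` W') y -> differentiable_along S (g \o psi) y].

Definition holomorphic_retraction (R : realType) (E : normedModType R[i])
    (U M : set E) (r : E -> E) :=
  [/\ holomorphic_on U r, r @` U = M & forall x, M x -> r x = x].

(* Main.v *)
Require Import Defs.
From HB Require Import structures.
From mathcomp Require Import all_boot all_order all_algebra.
From mathcomp Require Import complex ring lra.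
From mathcomp Require Import all_classical all_reals.
From mathcomp Require Import ereal topology normedtype landau derive.

Set Implicit Arguments.
Unset Strict Implicit.
Unset Printing Implicit Defensive.

Import Order.TTheory GRing.Theory Num.Theory.
Import numFieldNormedType.Exports.

Local Open Scope classical_set_scope.
Local Open Scope ring_scope.
Local Open Scope complex_scope.

(* Composing with automorphisms reduces the homogeneous case to f(0) = 0. On
   the unit ball the Caratheodory metric at 0 is the norm, so L = f'(0) is a
   linear isometry; property (V) gives a linear P of norm 1 with P L = id.
   Then P f is a self-map of the unit ball of E1 with derivative id at 0, so
   P f = id by Cartan's uniqueness theorem. Hence f P is a holomorphic
   retraction, P inverts f, and f(B1) is a graph over L(B1), flattened by
   y |-> y - (f (P y) - L (P y)).
   The complex analysis avoids integrals. Goursat's bisection shows that the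
   Riemann sums over the boundary of a square tend to 0; together with
   Landau's trick of taking large powers this yields the Schwarz lemma with
   its sharp constant. For Cartan's theorem, put D = h - id: if
   |D x| <= 2 |x|^k, the same holds for all iterates of h, whereas
   h^n x - x = n D x + n O(|x|^(k+1)), which forces |D x| <= 2 |x|^(k+1). *)

(** * Real-valued norms *)

(** Without a Cauchy formula there are no power series to work with. The analytic input is
    [cauchy_bound]: its constant [K] is far from sharp, but it depends only on the square and on the
    point, never on the function. It may therefore be applied to every power of one function, and
    taking roots makes [K] disappear. Two obstacles shape the rest. Bisection needs squares, whereas
    a sharp Schwarz lemma needs boundary values on circles; the Cayley transform turns discs around
    0 into discs in a half-plane, and squares are fitted around these. Singularities are not removed
    by a theorem: the functions are arranged to be O(h^2) at the bad point, which makes them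
    differentiable there. The Hahn-Banach theorem serves twice: it reduces vector-valued Schwarz
    lemmas to scalar ones, and it supplies the functionals that bound the Caratheodory metric from
    below. *)

Section RealNorm.
Variables (R : realType) (E : normedModType R[i]).
Implicit Types (x y : E) (c : R[i]).

Lemma normE x : `|x| = (rnorm x)%:C.
Proof. by rewrite /rnorm RRe_real ?normr_real. Qed.

Lemma rnorm_ge0 x : 0 <= rnorm x.
Proof. by rewrite -ler0c -normE. Qed.

Lemma rnorm0 : rnorm (0 : E) = 0.
Proof. by rewrite /rnorm normr0. Qed.

Lemma rnorm_eq0 x : rnorm x = 0 -> x = 0.
Proof. by move=> x0; apply: normr0_eq0; rewrite normE x0. Qed.

Lemma rnorm_gt0 x : x != 0 -> 0 < rnorm x.
Proof.
move=> x0; rewrite lt_neqAle rnorm_ge0 andbT.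
by apply: contraNneq x0 => /esym/rnorm_eq0 ->.
Qed.

Lemma rnormN x : rnorm (- x) = rnorm x.
Proof. by rewrite /rnorm normrN. Qed.

Lemma rnormD x y : rnorm (x + y) <= rnorm x + rnorm y.
Proof. by rewrite -lecR rmorphD/= -!normE ler_normD. Qed.

Lemma rnormBD x y : rnorm (x - y) <= rnorm x + rnorm y.
Proof. by rewrite -(rnormN y) rnormD. Qed.

Lemma rnormZ c x : rnorm (c *: x) = rnorm (c : R[i]^o) * rnorm x.
Proof. by apply: complexI; rewrite rmorphM/= -!normE normrZ. Qed.

Lemma rnorm_sum n (F : 'I_n -> E) : rnorm (\sum_i F i) <= \sum_i rnorm (F i).
Proof.
elim/big_ind2 : _ => // [|a b c d ac bd]; first by rewrite rnorm0.
by rewrite (le_trans (rnormD _ _))// lerD.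
Qed.

Lemma unit_ballE x : unit_ball x = (rnorm x < 1) :> Prop.
Proof. by rewrite /unit_ball/= normE ltcR. Qed.

Lemma norm_lt x (e : R) : (`|x| < e%:C) = (rnorm x < e).
Proof. by rewrite normE ltcR. Qed.

End RealNorm.

Section ComplexModulus.
Variable R : realType.
Implicit Types z w : R[i]^o.

Lemma rnorm1 : rnorm (1 : R[i]^o) = 1.
Proof. by rewrite /rnorm normr1. Qed.

Lemma rnormM z w : rnorm (z * w : R[i]^o) = rnorm z * rnorm w.
Proof. exact: (@rnormZ R R[i]^o). Qed.

Lemma rnormX z n : rnorm (z ^+ n : R[i]^o) = rnorm z ^+ n.
Proof. by elim: n => [|n ih]; rewrite ?expr0 ?rnorm1// !exprS rnormM ih. Qed.

Lemma rnormV z : rnorm (z^-1 : R[i]^o) = (rnorm z)^-1.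
Proof. by apply: complexI; rewrite fmorphV/= -!normE normfV. Qed.

Lemma rnorm_real (r : R) : rnorm (r%:C : R[i]^o) = `|r|.
Proof. by rewrite /rnorm normc_def/= expr0n addr0 sqrtr_sqr. Qed.

Lemma rnorm_nat n : rnorm (n%:R : R[i]^o) = n%:R.
Proof. by rewrite -(rmorph_nat (real_complex R)) rnorm_real ger0_norm. Qed.

Lemma rnorm_i : rnorm ('i : R[i]^o) = 1.
Proof. by rewrite /rnorm normc_def/= expr0n/= add0r expr1n sqrtr1. Qed.

Lemma sqr_rnorm z : rnorm z ^+ 2 = complex.Re z ^+ 2 + complex.Im z ^+ 2.
Proof. by apply: complexI; rewrite add_Re2_Im2 rmorphXn/= -normE. Qed.

Lemma Re_le_rnorm z : `|complex.Re z| <= rnorm z.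
Proof. by rewrite -lecR -normE normc_ge_Re. Qed.

Lemma Im_le_rnorm z : `|complex.Im z| <= rnorm z.
Proof.
rewrite -(@ler_pXn2r _ 2)// ?nnegrE ?rnorm_ge0 ?normr_ge0//.
by rewrite sqr_rnorm real_normK ?num_real// lerDr sqr_ge0.
Qed.

Lemma real_mulI (t : R) z : t%:C * ('i * z) = (0 +i* t) * z.
Proof.
rewrite mulrA; congr (_ * _); apply/eqP.
by rewrite eq_complex/= !mulr0 !mul0r !mulr1 subrr addr0 !eqxx.
Qed.

End ComplexModulus.

(** * Differentials in terms of the real-valued norm *)

Section Differential.
Variable R : realType.

Lemma gt0_real (e : R[i]) : 0 < e -> exists2 r : R, 0 < r & e = r%:C.
Proof.
move=> e0; exists (complex.Re e); last by rewrite RRe_real// gtr0_real.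
by move: e0; rewrite ltcE => /andP[].
Qed.

Lemma near_rnorm (E : normedModType R[i]) (x : E) (P : set E) :
  (\forall y \near x, P y) <->
  exists2 d : R, 0 < d & forall y, rnorm (y - x) < d -> P y.
Proof.
split.
  move=> /nbhs_normP[_ /= /gt0_real[d d0 ->] dP]; exists d => // y yd.
  by apply: dP; rewrite /ball_/= distrC norm_lt.
move=> [d d0 dP]; apply/nbhs_normP; exists d%:C; first by rewrite /= ltcR.
by move=> y /=; rewrite distrC norm_lt => /dP.
Qed.

Lemma diff_rnorm (E F : normedModType R[i]) (f : E -> F) (x : E) :
  differentiable f x -> forall e : R, 0 < e ->
  exists2 d : R, 0 < d & forall h, rnorm h < d ->
    rnorm (f (x + h) - f x - 'd f x h) <= e * rnorm h.
Proof.
move=> /diff_locally/eqaddoP fx e e0.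
have /fx : 0 < e%:C by rewrite ltcR.
move=> /near_rnorm[d d0 dP]; exists d => // h hd.
have := dP h; rewrite subr0 => /(_ hd) /=.
rewrite !fctE/= !normE -rmorphM lecR; apply: le_trans.
by rewrite opprD addrA (addrC x).
Qed.

(** Stands in for removable singularities: an O(h^2) bound alone gives differentiability, with
    derivative 0, at a point where a quotient takes only its default value. *)
Lemma differentiable_quadratic (E F : normedModType R[i]) (f : E -> F) (x : E)
    (K d : R) : 0 < d -> f x = 0 ->
  (forall h, rnorm h < d -> rnorm (f (x + h)) <= K * rnorm h ^+ 2) ->
  differentiable f x.
Proof.
move=> d0 fx0 fK.
have c0 : continuous (\0 : {linear E -> F}) by move=> y; exact: cvg_cst.
have o0 : f \o shift x = cst (f x) + (\0 : {linear E -> F}) +o_ 0 id.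
  apply/eqaddoP => _ /gt0_real[e e0 ->].
  apply/near_rnorm; exists (Num.min d (e / (`|K| + 1))).
    by rewrite lt_min d0 divr_gt0// ltr_wpDl.
  move=> y; rewrite subr0 lt_min => /andP[/fK yK ye].
  rewrite !fctE/= fx0 addr0 subr0 addrC !normE -rmorphM lecR.
  apply: (le_trans yK); rewrite expr2 mulrA ler_wpM2r ?rnorm_ge0//.
  move: ye; rewrite ltr_pdivlMr ?ltr_wpDl// => ye.
  have y0 := rnorm_ge0 y; have := ler_norm K; nra.
by apply/diff_locallyP; rewrite (diff_unique c0 o0).
Qed.

Lemma differentiable_lip (E F : normedModType R[i]) (f : E -> F) (x : E) :
  differentiable f x -> exists K d : R, [/\ 0 <= K, 0 < d & forall h,
    rnorm h < d -> rnorm (f (x + h) - f x) <= K * rnorm h].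
Proof.
move=> df; have [d d0 dP] := diff_rnorm df ltr01.
have [_ /gt0_real[k k0 ->] kP] := linear_lipschitz (diff_continuous df).
exists (1 + k), d; split=> [||h /dP hd]//; first exact: addr_ge0 (ltW k0).
rewrite -[f _ - _](subrK ('d f x h)) (le_trans (rnormD _ _))// mulrDl lerD//.
by have := kP h; rewrite !normE -rmorphM lecR.
Qed.

Lemma diff1 (f : R[i]^o -> R[i]^o) (z h : R[i]^o) :
  'd f z h = h * 'd f z (1 : R[i]^o).
Proof.
have h1 : h = h *: (1 : R[i]^o) by rewrite [RHS]mulr1.
by rewrite [in LHS]h1 linearZ.
Qed.

Lemma differentiable_near_eq (E F : normedModType R[i]) (f g : E -> F) (x : E) :
  (\forall y \near x, f y = g y) -> differentiable f x ->
  differentiable g x /\ 'd g x = 'd f x :> (E -> F).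
Proof.
move=> fg df; have fgx : f x = g x by exact: nbhs_singleton fg.
have gx : g \o shift x = cst (g x) + 'd f x +o_ 0 id.
  apply/eqaddoP => e e0.
  have /eqaddoP/(_ e e0) := diff_locally df.
  move: fg; rewrite (near_shift 0 x) => fg; apply: filterS2 fg => y /=.
  by rewrite !fctE/= subr0 fgx => ->.
have dgE := diff_unique (diff_continuous df) gx.
split; last exact: dgE.
by apply/diff_locallyP; rewrite dgE; split; [exact: diff_continuous|exact: gx].
Qed.

End Differential.

(** * Goursat's theorem for discrete contour sums *)

Section Goursat.
Variable R : realType.
Local Notation C := (R[i]^o).
Implicit Types (g : C -> C) (a d l z w : C).

(** Left-endpoint Riemann sum for the integral of [g] along the segment from [a] to [a + d]. A power
    of two as number of nodes makes halving the segment exact. *)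
Definition edge_sum (n : nat) g a d : C :=
  (\sum_(j < 2 ^ n) d * g (a + j%:R / 2 ^+ n * d)) / 2 ^+ n.

(* Opposite sides use the same nodes: the sums are then exactly additive under
   subdivision and exactly zero on affine functions. *)
Definition square_sum (n : nat) g a l : C :=
  edge_sum n g a l + edge_sum n g (a + l) ('i * l)
  - edge_sum n g (a + 'i * l) l - edge_sum n g a ('i * l).

Lemma edge_sum_split n g a d :
  edge_sum n.+1 g a d = edge_sum n g a (d / 2) + edge_sum n g (a + d / 2) (d / 2).
Proof.
have n2 : (2 ^+ n : C) != 0 by rewrite expf_neq0.
rewrite /edge_sum -mulrDl expnS mul2n -addnn big_split_ord /= exprS invfM mulrA.
congr (_ / _); rewrite mulrDl !mulr_suml; congr (_ + _); apply: eq_bigr => j _.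
  by rewrite mulrAC; congr (_ * g _); field.
by rewrite mulrAC natrD natrX; congr (_ * g _); field.
Qed.

(** Each of the four inner edges belongs to two quarter squares, with the same nodes and opposite
    signs, so the inner contributions cancel. *)
Lemma square_sum_split n g a l :
  square_sum n.+1 g a l =
  square_sum n g a (l / 2) + square_sum n g (a + l / 2) (l / 2) +
  square_sum n g (a + 'i * (l / 2)) (l / 2) +
  square_sum n g (a + l / 2 + 'i * (l / 2)) (l / 2).
Proof.
rewrite /square_sum !edge_sum_split.
(* The base points are brought to a common form, so that equal edges become the same atom for the
   final [ring]. *)
have -> : 'i * l / 2 = 'i * (l / 2) by rewrite mulrA.
have -> : a + l = a + l / 2 + l / 2 by field.
have -> : a + 'i * l = a + 'i * (l / 2) + 'i * (l / 2) by field.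
have -> : a + 'i * (l / 2) + 'i * (l / 2) + l / 2 =
    a + l / 2 + 'i * (l / 2) + 'i * (l / 2) by ring.
have -> : a + 'i * (l / 2) + l / 2 = a + l / 2 + 'i * (l / 2) by ring.
have -> : a + l / 2 + l / 2 + 'i * (l / 2) = a + l / 2 + 'i * (l / 2) + l / 2 by ring.
ring.
Qed.

Lemma square_sumD n g1 g2 a l :
  square_sum n (fun z => g1 z + g2 z) a l = square_sum n g1 a l + square_sum n g2 a l.
Proof.
have eD b d : edge_sum n (fun z => g1 z + g2 z) b d =
    edge_sum n g1 b d + edge_sum n g2 b d.
  rewrite /edge_sum -mulrDl -big_split/=; congr (_ / _).
  by apply: eq_bigr => j _; rewrite mulrDr.
rewrite /square_sum !eD; ring.
Qed.

Lemma square_sumZ n c g a l :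
  square_sum n (fun z => c * g z) a l = c * square_sum n g a l.
Proof.
have eZ b d : edge_sum n (fun z => c * g z) b d = c * edge_sum n g b d.
  rewrite /edge_sum mulrA mulr_sumr; congr (_ / _).
  by apply: eq_bigr => j _; rewrite mulrCA.
rewrite /square_sum !eZ; ring.
Qed.

(** Translating an edge [d] by [v] changes its sum by exactly [c1 * v * d]. Both pairs of opposite
    sides thus differ by [c1 * l * ('i * l)], with opposite signs. *)
Lemma square_sum_affine n (c0 c1 : C) a l :
  square_sum n (fun z => c0 + c1 * z) a l = 0.
Proof.
have n2 : (2 ^+ n : C) != 0 by rewrite expf_neq0.
have eB b v d : edge_sum n (fun z => c0 + c1 * z) (b + v) d =
    edge_sum n (fun z => c0 + c1 * z) b d + c1 * v * d.
  rewrite /edge_sum -[c1 * v * d](mulfK n2) -mulrDl; congr (_ / _).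
  transitivity (\sum_(j < 2 ^ n) (d * (c0 + c1 * (b + j%:R / 2 ^+ n * d)) + d * (c1 *
      v))).
    by apply: eq_bigr => j _; ring.
  by rewrite big_split/= sumr_const card_ord -[(d * _) *+ _]mulr_natr natrX; ring.
rewrite /square_sum !eB; ring.
Qed.

Lemma rnorm_edge_sum n g a d (M : R) :
  (forall t : R, 0 <= t <= 1 -> rnorm (g (a + t%:C * d)) <= M) ->
  rnorm (edge_sum n g a d) <= rnorm d * M.
Proof.
move=> gM; rewrite /edge_sum rnormM rnormV rnormX.
rewrite rnorm_nat ler_pdivrMr ?exprn_gt0// (le_trans (rnorm_sum _))//.
have -> : rnorm d * M * 2 ^+ n = \sum_(j < 2 ^ n) rnorm d * M.
  by rewrite sumr_const card_ord -natrX mulr_natr.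
apply: ler_sum => j _.
rewrite rnormM ler_wpM2l ?rnorm_ge0//.
have -> : (j%:R / 2 ^+ n : C) = ((j%:R / 2 ^+ n : R))%:C.
  by rewrite rmorphM/= fmorphV/= rmorphXn/= !rmorph_nat.
apply: gM; rewrite divr_ge0 ?exprn_ge0//= ler_pdivrMr ?exprn_gt0// mul1r.
by rewrite -natrX ler_nat ltnW.
Qed.

Lemma rnorm_square_sum n g a l (M : R) :
  (forall s t : R, 0 <= s <= 1 -> 0 <= t <= 1 ->
    [|| s == 0, s == 1, t == 0 | t == 1] -> rnorm (g (a + (s +i* t) * l)) <= M) ->
  rnorm (square_sum n g a l) <= 4 * rnorm l * M.
Proof.
move=> gM; have h0 : (0 : R) <= (0 : R) <= 1 by apply/andP; split;
    [exact: lexx|exact: ler01].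
have h1 : (0 : R) <= (1 : R) <= 1 by apply/andP; split; [exact: ler01|exact: lexx].
have il : rnorm ('i * l) = rnorm l by rewrite rnormM rnorm_i mul1r.
have e1 : rnorm (edge_sum n g a l) <= rnorm l * M.
  by apply: rnorm_edge_sum => t t01; apply: gM; rewrite ?eqxx ?orbT.
have e2 : rnorm (edge_sum n g (a + l) ('i * l)) <= rnorm l * M.
  rewrite -il; apply: rnorm_edge_sum => t t01;
      rewrite real_mulI -addrA -{1}[l]mul1r -mulrDl.
  have -> : (1 : C) + (0 +i* t) = 1 +i* t by apply/eqP;
      rewrite eq_complex/= addr0 add0r !eqxx.
  by apply: gM; rewrite ?eqxx ?orbT.
have e3 : rnorm (edge_sum n g (a + 'i * l) l) <= rnorm l * M.
  apply: rnorm_edge_sum => t t01; rewrite -addrA -mulrDl.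
  have -> : ('i : C) + t%:C = t +i* 1 by apply/eqP;
      rewrite eq_complex/= addr0 add0r !eqxx.
  by apply: gM; rewrite ?eqxx ?orbT.
have e4 : rnorm (edge_sum n g a ('i * l)) <= rnorm l * M.
  by rewrite -il; apply: rnorm_edge_sum => t t01; rewrite real_mulI; apply: gM;
      rewrite ?eqxx ?orbT.
rewrite /square_sum.
have := rnormBD (edge_sum n g a l + edge_sum n g (a + l) ('i * l)
  - edge_sum n g (a + 'i * l) l) (edge_sum n g a ('i * l)).
have := rnormBD (edge_sum n g a l + edge_sum n g (a + l) ('i * l))
  (edge_sum n g (a + 'i * l) l).
have := rnormD (edge_sum n g a l) (edge_sum n g (a + l) ('i * l)).
lra.
Qed.

Lemma rnorm_ReIm (u v : R) : rnorm (u +i* v : C) <= `|u| + `|v|.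
Proof.
have -> : (u +i* v : C) = u%:C + 'i * v%:C.
  exact: complexE.
by rewrite (le_trans (rnormD _ _))// rnormM rnorm_i mul1r !rnorm_real.
Qed.

(** The affine part of [g] at [p] contributes nothing. The remainder is at most [e] times the
    distance to [p], hence at most [2 * e * rnorm m] on a contour of length [4 * rnorm m]. *)
Lemma rnorm_square_sum_local n g (b m : C) (s t D e : R) : 0 <= s <= 1 -> 0 <= t <= 1 ->
  let p : C := b + (s +i* t) * m in
  (forall h : C, rnorm h < D -> rnorm (g (p + h) - g p - 'd g p h) <= e * rnorm h) ->
  0 <= e -> 2 * rnorm m < D ->
  rnorm (square_sum n g b m) <= 8 * e * rnorm m ^+ 2.
Proof.
move=> s01 t01 p gP e0 mD; set c := 'd g p (1 : C).
pose r z := g z - g p - 'd g p (z - p).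
have -> : g = (fun z => (g p - c * p + c * z) + r z).
  by apply/funext => z; rewrite /r (diff1 _ _ (z - p)) -/c; ring.
rewrite (square_sumD _ (fun z => g p - c * p + c * z)) square_sum_affine add0r.
have -> : 8 * e * rnorm m ^+ 2 = 4 * rnorm m * (e * (2 * rnorm m)) by ring.
apply: rnorm_square_sum => u v u01 v01 _.
set z := b + _; have zp : rnorm (z - p) <= 2 * rnorm m.
  have -> : z - p = ((u - s) +i* (v - t)) * m.
    by rewrite /z /p opprD addrACA subrr add0r -mulrBl.
  rewrite rnormM ler_wpM2r ?rnorm_ge0// (le_trans (rnorm_ReIm _ _))//.
  have -> : (2 : R) = 1 + 1 by [].
  by apply: lerD; rewrite ler_norml; apply/andP; split; lra.
have := gP (z - p) (le_lt_trans zp mD).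
by rewrite (addrC p) subrK => /le_trans-> //; rewrite ler_wpM2l.
Qed.

End Goursat.

(** The left end moves by at most half of the current length, so each interval contains the next;
    the supremum of the left ends lies in all of them. *)
Lemma dyadic_nested (R : realType) (s : nat -> R) :
  (forall k, s k <= s k.+1 <= s k + (2 ^+ k.+1)^-1) ->
  exists x, forall k, s k <= x <= s k + (2 ^+ k)^-1.
Proof.
move=> sS; have h2 k : (2 ^+ k)^-1 = (2 ^+ k.+1)^-1 + (2 ^+ k.+1)^-1 :> R.
  have : (2 ^+ k : R) != 0 by rewrite expf_neq0.
  by rewrite exprS => ?; field.
have s_ndecr : {homo s : i j / (i <= j)%N >-> i <= j}.
  by apply: homo_leq => // [x y z|k]; [exact: le_trans|case/andP: (sS k)].
have t_nincr : {homo (fun k => s k + (2 ^+ k)^-1) : i j / (i <= j)%N >-> j <= i}.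
  apply: homo_leq => // [x y z xy yz|k]; first exact: le_trans yz xy.
  by have /andP[_ ?] := sS k; rewrite (h2 k) addrA lerD2r.
have ub j k : s j <= s k + (2 ^+ k)^-1.
  apply: (le_trans (s_ndecr j (maxn j k) (leq_maxl _ _))).
  apply: le_trans (t_nincr k (maxn j k) (leq_maxr _ _)).
  by rewrite lerDl invr_ge0 exprn_ge0.
have ss : has_sup (range s).
  by split; [exists (s 0%N), 0%N|exists (s 0%N + (2 ^+ 0)^-1) => _ [j _ <-]].
exists (sup (range s)) => k; apply/andP; split.
  by apply: sup_upper_bound => //; exists k.
by apply: sup_le_ub => [|_ [j _ <-]]; [exact: ss.1|].
Qed.

Section GoursatTheorem.
Variable R : realType.
Local Notation C := (R[i]^o).

Theorem goursat (g : C -> C) (a l : C) :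
  (forall s t : R, 0 <= s <= 1 -> 0 <= t <= 1 ->
    differentiable g (a + (s +i* t) * l)) ->
  forall e : R, 0 < e -> exists N, forall n, (N <= n)%N ->
    rnorm (square_sum n g a l) <= e.
Proof.
move=> dg e e0; have l2 : 0 < rnorm l ^+ 2 + 1 by rewrite ltr_wpDl// sqr_ge0.
(* Bounds proportional to the area add up under subdivision; [e'] is the share per unit of area, and
   the summand 1 covers [l = 0]. *)
pose e' := e / (rnorm l ^+ 2 + 1); have e'0 : 0 < e' by rewrite divr_gt0.
pose side k : C := l / 2 ^+ k.
pose good k (p : R * R) := exists N, forall n, (N <= n)%N ->
  rnorm (square_sum n g (a + (p.1 +i* p.2) * l) (side k)) <= e' * rnorm (side k) ^+ 2.
suff [N NP] : good 0%N (0, 0).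
  exists N => n /NP; rewrite /side expr0 divr1 /= [_ * l]mul0r addr0.
  move/le_trans; apply; rewrite /e' mulrAC ler_pdivrMr//.
  by rewrite ler_wpM2l ?(ltW e0)// lerDl.
apply: contrapT => bad0.
have side2 k : side k / 2 = side k.+1.
  by rewrite /side exprS -mulrA -invfM [2 ^+ _ * 2]mulrC.
have rside k : rnorm (side k.+1) = rnorm (side k) / 2.
  by rewrite -side2 rnormM rnormV rnorm_nat.
(* If all four quarters were good, their bounds would add up to the bound for the square; so a bad
   square has a bad quarter. The implication stands under the existential so that [choice] yields a
   total function. *)
have step (kp : nat * (R * R)) : exists q : R * R,
    ~ good kp.1 kp.2 -> [/\ ~ good kp.1.+1 q,
      kp.2.1 <= q.1 <= kp.2.1 + (2 ^+ kp.1.+1)^-1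
    & kp.2.2 <= q.2 <= kp.2.2 + (2 ^+ kp.1.+1)^-1].
  case: kp => k [s t] /=; set h := (2 ^+ k.+1)^-1.
  have h0 : 0 <= h by rewrite invr_ge0 exprn_ge0.
  apply: contrapT => /forallNP noq.
  have allgood u v : s <= u <= s + h -> t <= v <= t + h -> good k.+1 (u, v).
    move=> su tv; apply: contrapT => b; apply: (noq (u, v)) => _.
    by split.
  have sh : s <= s + h by rewrite lerDl.
  have th : t <= t + h by rewrite lerDl.
  have [N1 N1P] : good k.+1 (s, t) by apply: allgood; rewrite lexx.
  have [N2 N2P] : good k.+1 (s + h, t) by apply: allgood; rewrite lexx ?andbT.
  have [N3 N3P] : good k.+1 (s, t + h) by apply: allgood; rewrite lexx ?andbT.
  have [N4 N4P] : good k.+1 (s + h, t + h) by apply: allgood; rewrite lexx ?andbT.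
  apply: (noq (s, t)) => nb; exfalso; apply: nb.
  (* The successor is there because level [n.+1] on a square is level [n] on its quarters. *)
  exists (maxn (maxn N1 N2) (maxn N3 N4)).+1 => -[//|n].
  rewrite ltnS !geq_max => /andP[/andP[n1 n2] /andP[n3 n4]].
  rewrite square_sum_split !side2 /=.
  move: (N1P _ n1) (N2P _ n2) (N3P _ n3) (N4P _ n4) => /=.
  have hl : side k.+1 = h%:C * l.
    by rewrite /side /h fmorphV rmorphXn/= rmorph_nat mulrC.
  have ih : 'i * (h%:C : C) = 0 +i* h.
    by apply/eqP; rewrite eq_complex/= !mul0r !mul1r subrr add0r !eqxx.
  have -> : a + ((s + h) +i* t) * l = a + (s +i* t) * l + side k.+1.
    rewrite hl -addrA -mulrDl; congr (_ + _ * _).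
    by apply/eqP; rewrite eq_complex/= addr0 !eqxx.
  have -> : a + (s +i* (t + h)) * l = a + (s +i* t) * l + 'i * side k.+1.
    rewrite hl mulrA ih -addrA -mulrDl; congr (_ + _ * _).
    by apply/eqP; rewrite eq_complex/= addr0 !eqxx.
  have -> : a + ((s + h) +i* (t + h)) * l =
      a + (s +i* t) * l + side k.+1 + 'i * side k.+1.
    rewrite hl mulrA ih -!addrA -!mulrDl; congr (_ + _ * _).
    by apply/eqP; rewrite eq_complex/= addr0 add0r !eqxx.
  have eE : e' * rnorm (side k.+1) ^+ 2 = e' * rnorm (side k) ^+ 2 / 4.
    by rewrite rside; field.
  rewrite eE => H1 H2 H3 H4.
  have -> : e' * rnorm (side k) ^+ 2 = e' * rnorm (side k) ^+ 2 / 4 +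
    e' * rnorm (side k) ^+ 2 / 4 + e' * rnorm (side k) ^+ 2 / 4 +
    e' * rnorm (side k) ^+ 2 / 4 by field.
  do 3 (apply: (le_trans (rnormD _ _)); apply: lerD => //).
have [F FP] := choice step.
pose u := fix u k := if k is j.+1 then F (j, u j) else (0, 0).
have uP k : ~ good k (u k) by elim: k => [//|k /(FP (k, u k))[]].
have [x xP] := @dyadic_nested R (fun k => (u k).1) (fun k => let:
    And3 _ h _ := FP (k, u k) (uP k) in h).
have [y yP] := @dyadic_nested R (fun k => (u k).2) (fun k => let:
    And3 _ _ h := FP (k, u k) (uP k) in h).
have dp : differentiable g (a + (x +i* y) * l).
  by apply: dg; [have := xP 0%N|have := yP 0%N]; rewrite /= expr0 invr1 add0r.
(* The divisor 8 offsets the factor of [rnorm_square_sum_local]. That estimate holds at every level,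
   so a bad square small enough around the limit point is good with threshold 0. *)
have [d d0 dP] := diff_rnorm dp (divr_gt0 e'0 (ltr0n R 8)).
have [k kd] : exists k, 2 * rnorm (side k) < d.
  exists (Num.bound (2 * rnorm l / d)).
  rewrite /side rnormM rnormV rnormX rnorm_nat.
  rewrite mulrA ltr_pdivrMr ?exprn_gt0// [d * _]mulrC -ltr_pdivrMr//.
  apply: (@lt_trans _ _ (Num.bound (2 * rnorm l / d))%:R).
    by apply: archi_boundP; rewrite divr_ge0 ?(ltW d0)// mulr_ge0 ?rnorm_ge0.
  by rewrite -natrX ltr_nat ltn_expl.
apply: (uP k); exists 0%N => n _.
pose s := (x - (u k).1) * 2 ^+ k; pose t := (y - (u k).2) * 2 ^+ k.
have k2 : 0 < (2 ^+ k : R) by rewrite exprn_gt0.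
have st01 (v w : R) : v <= w <= v + (2 ^+ k)^-1 -> 0 <= (w - v) * 2 ^+ k <= 1.
  move=> /andP[vw wv]; apply/andP; split; first by rewrite mulr_ge0 ?subr_ge0// ltW.
  by rewrite -ler_pdivlMr// mul1r lerBlDl.
have sl : side k = ((2 ^+ k)^-1)%:C * l.
  by rewrite /side fmorphV rmorphXn/= rmorph_nat mulrC.
have pE : a + ((u k).1 +i* (u k).2) * l + (s +i* t) * side k = a + (x +i* y) * l.
  rewrite sl mulrA -addrA -mulrDl; congr (_ + _ * _).
  apply/eqP; rewrite eq_complex/= !mulr0 subr0 add0r /s /t !mulfK ?(lt0r_neq0 k2)//.
  by rewrite !subrKC !eqxx.
have e8 : e' = 8 * (e' / 8) by field.
rewrite {1}e8; apply: (rnorm_square_sum_local _ (st01 _ _ (xP k)) (st01 _ _ (yP k))) kd.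
  by rewrite pE; exact: dP.
by rewrite divr_ge0 ?(ltW e'0).
Qed.

End GoursatTheorem.

(** * A bound at interior points by boundary values *)

Section CauchyBound.
Variable R : realType.
Local Notation C := (R[i]^o).

Lemma differentiable_cdiv (g h : C -> C) (z : C) : differentiable g z ->
  differentiable h z -> h z != 0 -> differentiable (fun w => g w / h w : C) z.
Proof.
by move=> dg dh h0; exact:
    (@differentiableM _ _ g (fun w => (h w)^-1) _ dg (differentiableV dh h0)).
Qed.

Lemma differentiable_cX (g : C -> C) (z : C) n : differentiable g z ->
  differentiable (fun w => g w ^+ n : C) z.
Proof.
move=> dg; case: n => [|n]; first exact: differentiable_cst.
by have := differentiableX n dg; rewrite exprfctE.
Qed.

Lemma differentiable_csub (g : C -> C) (c z : C) : differentiable g z ->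
  differentiable (fun w => g w - c : C) z.
Proof. by move=> dg; exact: (differentiableB dg (differentiable_cst c z)). Qed.

Lemma differentiable_cid (z : C) : differentiable (fun w : C => w) z.
Proof. exact: (@ex_diff _ _ _ _ _ _ _ (is_diff_id z)). Qed.

Lemma Im_edge_sum_ge n (g : C -> C) (a d : C) (m : R) :
  (forall t : R, 0 <= t <= 1 -> m <= complex.Im (d * g (a + t%:C * d))) ->
  m <= complex.Im (edge_sum n g a d).
Proof.
move=> gm; have n2 : 0 < (2 ^+ n : R) by rewrite exprn_gt0.
have ImM (r : R) (z : C) : complex.Im (z * r%:C) = complex.Im z * r.
  by case: z => x y /=; rewrite mulr0 add0r.
have -> : edge_sum n g a d = (\sum_(j < 2 ^ n)
    d * g (a + (j%:R / 2 ^+ n)%:C * d)) * ((2 ^+ n)^-1)%:C.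
  have e2 : ((2 ^+ n)^-1)%:C = (2 ^+ n)^-1 :> C
      by rewrite fmorphV/= rmorphXn/= rmorph_nat.
  rewrite /edge_sum e2; congr (_ / _); apply: eq_bigr => j _.
  by rewrite rmorphM/= rmorph_nat e2.
rewrite ImM ler_pdivlMr// (raddf_sum (@complex.Im R : Rcomplex R -> R)).
have -> : m * 2 ^+ n = \sum_(j < 2 ^ n) m.
  by rewrite sumr_const card_ord -natrX mulr_natr.
apply: ler_sum => j _; apply: gm; rewrite divr_ge0 ?exprn_ge0//=.
by rewrite ler_pdivrMr// mul1r -natrX ler_nat ltnW.
Qed.

Lemma Im_edge_sum_le n (g : C -> C) (a d : C) (m : R) :
  (forall t : R, 0 <= t <= 1 -> complex.Im (d * g (a + t%:C * d)) <= m) ->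
  complex.Im (edge_sum n g a d) <= m.
Proof.
have ImN (z : C) : complex.Im (- z) = - complex.Im z by case: z.
move=> gm; rewrite -lerN2 -ImN.
have -> : - edge_sum n g a d = edge_sum n (fun z => - g z) a d.
  rewrite /edge_sum -mulNr -sumrN; congr (_ / _).
  by apply: eq_bigr => j _; rewrite mulrN.
by apply: Im_edge_sum_ge => t t01; rewrite mulrN ImN lerN2 gm.
Qed.

Lemma complexV (u v : R) : (u +i* v : C)^-1 =
  (u / (u ^+ 2 + v ^+ 2)) +i* (- (v / (u ^+ 2 + v ^+ 2))).
Proof. by []. Qed.

(** Substitute for the winding number: only a lower bound valid for all [n] is wanted. In units of
    [l], a side at distance q from the point contributes at least q / 2, because q / (u^2 + q^2) >=
    q / 2 when |u| and q are at most 1. The four distances add up to 2. *)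
Lemma Im_square_sum_ge1 n (a : C) (l s0 t0 : R) : 0 < l ->
  0 < s0 < 1 -> 0 < t0 < 1 ->
  1 <= complex.Im (square_sum n (fun z => (z - (a + (s0 +i* t0) * l%:C))^-1) a l%:C).
Proof.
move=> l0 /andP[s0_0 s0_1] /andP[t0_0 t0_1]; set w0 := a + _.
have lC : (l%:C : C) != 0 by rewrite (inj_eq (@complexI R)) gt_eqF.
have ptE (s t : R) : l%:C * (a + (s +i* t) * l%:C - w0)^-1 =
    ((s - s0) +i* (t - t0))^-1 :> C.
  have -> : a + (s +i* t) * l%:C - w0 = ((s - s0) +i* (t - t0)) * l%:C.
    by rewrite /w0 opprD addrACA subrr add0r -mulrBl.
  by rewrite invfM mulrCA divff// mulr1.
have le2 (q u : R) : 0 < q -> q < 1 -> -1 <= u -> u <= 1 -> q / 2 <=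
    q / (u ^+ 2 + q ^+ 2).
  move=> q0 q1 u1 u2; rewrite ler_pM2l// lef_pV2 ?posrE//; last first.
    by rewrite ltr_wpDl ?sqr_ge0 ?exprn_gt0.
  suff : 0 <= (1 - u) * (1 + u) /\ 0 <= (1 - q) * (1 + q) by lra.
  by split; apply: mulr_ge0; lra.
have ImiM (z : C) : complex.Im ('i * z) = complex.Re z.
  by case: z => x y /=; rewrite mul0r mul1r add0r.
have e1 : t0 / 2 <= complex.Im (edge_sum n (fun z => (z - w0)^-1) a l%:C).
  apply: Im_edge_sum_ge => t /andP[t_0 t_1];
      rewrite ptE complexV/= sub0r mulNr opprK sqrrN.
  by apply: le2; lra.
have e2 : (1 - s0) / 2 <= complex.Im (edge_sum n (fun z => (z - w0)^-1) (a + l%:C) ('i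
    * l%:C)).
  apply: Im_edge_sum_ge => t /andP[t_0 t_1]; rewrite real_mulI.
  have e1t : (1 : C) + (0 +i* t) = 1 +i* t by apply/eqP;
      rewrite eq_complex/= addr0 add0r !eqxx.
  have -> : a + l%:C + (0 +i* t) * l%:C = a + (1 +i* t) * l%:C :> C.
    by rewrite -e1t mulrDl mul1r addrA.
  by rewrite -mulrA ptE complexV ImiM/= [X in _ <= _ / X]addrC; apply: le2; lra.
have e3 : complex.Im (edge_sum n (fun z => (z - w0)^-1) (a + 'i * l%:C) l%:C) <=
    - ((1 - t0) / 2).
  apply: Im_edge_sum_le => t /andP[t_0 t_1];
      have eit : ('i : C) + t%:C = t +i* 1 by apply/eqP;
      rewrite eq_complex/= addr0 add0r !eqxx.
  have -> : a + 'i * l%:C + t%:C * l%:C = a + (t +i* 1) * l%:C :> C.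
    by rewrite -eit mulrDl addrA.
  by rewrite ptE complexV/= lerN2; apply: le2; lra.
have e4 : complex.Im (edge_sum n (fun z => (z - w0)^-1) a ('i * l%:C)) <= - (s0 / 2).
  apply: Im_edge_sum_le => t /andP[t_0 t_1];
      rewrite real_mulI -mulrA ptE complexV ImiM/=.
  by rewrite sub0r mulNr lerN2 sqrrN [X in _ <= _ / X]addrC; apply: le2; lra.
have ImB (x y : C) : complex.Im (x - y) = complex.Im x - complex.Im y by case: x;
    case: y.
have ImD (x y : C) : complex.Im (x + y) = complex.Im x + complex.Im y by case: x;
    case: y.
rewrite /square_sum !ImB ImD; lra.
Qed.

End CauchyBound.

Section MaximumBound.
Variable R : realType.
Local Notation C := (R[i]^o).

(* The cube makes the Cauchy kernel differentiable at [w0] too, so that Goursat's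
   theorem applies without an exceptional point. *)
Lemma differentiable_cubic_kernel (g : C -> C) (w0 z : C) :
  differentiable g z ->
  differentiable (fun w => (g w - g w0) ^+ 3 / (w - w0) : C) z.
Proof.
move=> dg; have [zw|zw] := eqVneq z w0; last first.
  apply: differentiable_cdiv; last by rewrite subr_eq0.
  - by apply: differentiable_cX; exact: differentiable_csub.
  - by apply: differentiable_csub; exact: differentiable_cid.
rewrite {}zw in dg *; have [K [d [K0 d0 dP]]] := differentiable_lip dg.
apply: (@differentiable_quadratic _ _ _ _ _ (K ^+ 3) d) => //.
  by rewrite subrr expr0n/= mul0r.
move=> h hd; have -> : w0 + h - w0 = h by rewrite addrAC subrr add0r.
rewrite rnormM rnormV rnormX.
have [->|h0] := eqVneq h 0; first by rewrite rnorm0 invr0 mulr0 mulr_ge0 ?exprn_ge0.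
rewrite ler_pdivrMr ?rnorm_gt0// -mulrA -exprSr -exprMn.
by rewrite lerXn2r ?nnegrE ?rnorm_ge0 ?mulr_ge0 ?rnorm_ge0// dP.
Qed.

(** Expanding the cube in the kernel writes a contour sum that tends to 0 as a combination of the
    sums [A k] of [g ^+ k / (z - w0)]. The term with [A 0] has modulus at least [x ^+ 3], where
    [x = rnorm (g w0)]; the others are bounded by the boundary values and carry at most [x ^+ 2].
    Dividing by [x ^+ 2] bounds [x]. *)
Theorem cauchy_bound (a : C) (l s0 t0 : R) : 0 < l -> 0 < s0 < 1 -> 0 < t0 < 1 ->
  exists2 K : R, 0 < K & forall (g : C -> C) (M : R), 0 < M ->
    (forall s t : R, 0 <= s <= 1 -> 0 <= t <= 1 ->
      differentiable g (a + (s +i* t) * l%:C)) ->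
    (forall s t : R, 0 <= s <= 1 -> 0 <= t <= 1 ->
      [|| s == 0, s == 1, t == 0 | t == 1] ->
      rnorm (g (a + (s +i* t) * l%:C)) <= M) ->
    rnorm (g (a + (s0 +i* t0) * l%:C)) <= K * M.
Proof.
(* [mu] is the distance from the point to the boundary of the square, in units of the side. *)
move=> l0 s01 t01; pose mu := Num.min (Num.min s0 (1 - s0)) (Num.min t0 (1 - t0)).
have mu0 : 0 < mu.
  by move: s01 t01 => /andP[? ?] /andP[? ?]; rewrite !lt_min; apply/andP; split;
      apply/andP; split; lra.
set w0 : C := a + _.
(* 28 is 4 * (1 + 3 + 3): the factor 4 of the perimeter times the binomial coefficients of [A 3],
   [A 2] and [A 1]. The summand 1 absorbs the error [x ^+ 2 * M] allowed to the Goursat sum. *)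
exists (28 / mu + 1) => [|g M M0 dg gM]; first by rewrite addr_gt0// divr_gt0.
set x := rnorm (g w0); rewrite leNgt; apply/negP => xK.
have Mx : M < x by apply: le_lt_trans xK;
    rewrite ler_peMl ?(ltW M0)// lerDr divr_ge0// ltW.
have x0 : 0 < x by exact: lt_trans Mx.
have [N /(_ N (leqnn N))] := goursat (fun s t hs ht => differentiable_cubic_kernel w0
    (dg s t hs ht)) (mulr_gt0 (exprn_gt0 2 x0) M0).
pose A k := square_sum N (fun z => g z ^+ k / (z - w0) : C) a l%:C.
have -> : square_sum N (fun z => (g z - g w0) ^+ 3 / (z - w0) : C) a l%:C =
   A 3 + - 3 * g w0 * A 2 + 3 * g w0 ^+ 2 * A 1 + - g w0 ^+ 3 * A 0%N.
  rewrite /A -!square_sumZ -!square_sumD; congr (square_sum _ _ _ _).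
  by apply/funext => z; ring.
have Ak k : rnorm (A k) <= 4 * M ^+ k / mu.
  have rl : rnorm (l%:C : C) = l by rewrite rnorm_real gtr0_norm.
  have -> : 4 * M ^+ k / mu = 4 * rnorm (l%:C : C) * (M ^+ k / (l * mu)).
    by rewrite rl; field; rewrite !gt_eqF.
  apply: rnorm_square_sum => s t s1 t1 st.
  rewrite rnormM rnormV rnormX ler_pM ?invr_ge0 ?exprn_ge0 ?rnorm_ge0//.
    by rewrite lerXn2r ?nnegrE ?rnorm_ge0 ?(ltW M0)// gM.
  have zw : a + (s +i* t) * l%:C - w0 = ((s - s0) +i* (t - t0)) * l%:C.
    by rewrite /w0 opprD addrACA subrr add0r -mulrBl.
  have lmu : l * mu <= rnorm (a + (s +i* t) * l%:C - w0).
    rewrite zw rnormM rl mulrC ler_wpM2r ?(ltW l0)//.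
    have := Re_le_rnorm ((s - s0) +i* (t - t0));
        have := Im_le_rnorm ((s - s0) +i* (t - t0)).
    rewrite /= !ler_norml => /andP[i1 i2] /andP[r1 r2].
    have [m1 m2 m3 m4] : [/\ mu <= s0, mu <= 1 - s0, mu <= t0 & mu <= 1 - t0].
      by rewrite /mu !ge_min !lexx ?orbT.
    by case/or4P: st => /eqP st; rewrite st in i1 i2 r1 r2 *; lra.
  by rewrite lef_pV2 ?posrE ?(lt_le_trans (mulr_gt0 l0 mu0) lmu) ?(mulr_gt0 l0 mu0).
set S := A 3 + _ + _; have A0 : 1 <= rnorm (A 0%N).
  have -> : A 0%N = square_sum N (fun z => (z - w0)^-1) a l%:C.
    by congr (square_sum _ _ _ _); apply/funext => z; rewrite expr0 mul1r.
  by apply: le_trans (Im_square_sum_ge1 N a l0 s01 t01) (le_trans (ler_norm _)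
      (Im_le_rnorm _)).
have S3 : rnorm S <= 4 / mu * (M ^+ 3 + 3 * x * M ^+ 2 + 3 * x ^+ 2 * M).
  have -> : 4 / mu * (M ^+ 3 + 3 * x * M ^+ 2 + 3 * x ^+ 2 * M) =
    4 * M ^+ 3 / mu + 3 * x * (4 * M ^+ 2 / mu) + 3 * x ^+ 2 * (4 * M ^+ 1 / mu).
    by rewrite expr1; ring.
  apply: (le_trans (rnormD _ _)); apply: lerD.
    apply: (le_trans (rnormD _ _)); apply: lerD; first exact: Ak.
    by rewrite !rnormM rnormN rnorm_nat ler_wpM2l ?mulr_ge0// ltW.
  rewrite rnormM rnormM rnormX rnorm_nat; apply: ler_wpM2l; last exact: Ak.
  by rewrite mulr_ge0// exprn_ge0// ltW.
move=> SA; have x3 : x ^+ 3 <= x ^+ 2 * M + rnorm S.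
  apply: (@le_trans _ _ (rnorm (g w0 ^+ 3 * A 0%N))).
    by rewrite rnormM rnormX ler_peMr// exprn_ge0// ltW.
  have -> : g w0 ^+ 3 * A 0%N = S - (S + - g w0 ^+ 3 * A 0%N) by ring.
  by apply: (le_trans (rnormBD _ _)); rewrite addrC lerD2r.
have : 4 / mu * (M ^+ 3 + 3 * x * M ^+ 2 + 3 * x ^+ 2 * M) <= 28 / mu * x ^+ 2 * M.
  have -> : 28 / mu * x ^+ 2 * M =
      4 / mu * (x ^+ 2 * M + 3 * x ^+ 2 * M + 3 * x ^+ 2 * M) by ring.
  rewrite ler_wpM2l ?divr_ge0 ?(ltW mu0)//.
  have h1 : M ^+ 3 <= x ^+ 2 * M
      by rewrite exprSr ler_wpM2r ?(ltW M0)// lerXn2r ?nnegrE ?(ltW M0) ?(ltW x0)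
      ?(ltW Mx).
  have h2 : 3 * x * M ^+ 2 <= 3 * x ^+ 2 * M.
    have -> : 3 * x * M ^+ 2 = 3 * (x * M) * M by ring.
    have -> : 3 * x ^+ 2 * M = 3 * (x * x) * M by ring.
    by rewrite ler_pM2r// ler_pM2l// ler_pM2l// ltW.
  lra.
move=> h; have : (28 / mu + 1) * M * x ^+ 2 < x ^+ 3
    by rewrite [x ^+ 3]exprS ltr_pM2r ?exprn_gt0.
have -> : (28 / mu + 1) * M * x ^+ 2 = 28 / mu * x ^+ 2 * M + x ^+ 2 * M by ring.
lra.
Qed.

End MaximumBound.

(** * Schwarz lemmas *)

Section Schwarz.
Variable R : realType.
Local Notation C := (R[i]^o).

Lemma bernoulli (e : R) n : -1 <= e -> 1 + n%:R * e <= (1 + e) ^+ n.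
Proof.
move=> e1; elim: n => [|n ih]; first by rewrite mul0r addr0 expr0.
rewrite exprSr; apply: (@le_trans _ _ ((1 + n%:R * e) * (1 + e))).
  have := sqr_ge0 e; have : 0 <= n%:R :> R by []; rewrite -natr1; nra.
by apply: ler_wpM2r => //; lra.
Qed.

(** Landau's trick without roots: if [m < q], Bernoulli's inequality makes [(q / m) ^+ n] exceed
    [K / c]. *)
Lemma ler_of_powers (c K q m : R) : 0 < c -> 0 <= m ->
  (forall n, c * q ^+ n <= K * m ^+ n) -> q <= m.
Proof.
move=> c0 m0 qm; rewrite leNgt; apply/negP => mq.
have q0 : 0 < q by exact: le_lt_trans mq.
have [m00|mN0] := eqVneq m 0.
  have := qm 1%N; rewrite m00 !expr1 mulr0; apply/negP; rewrite -ltNge.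
  exact: mulr_gt0.
have {mN0}m0 : 0 < m by rewrite lt_neqAle eq_sym mN0.
pose e := q / m - 1; have e0 : 0 < e by rewrite subr_gt0 ltr_pdivlMr// mul1r.
pose n := Num.bound (`|K| / c / e).
have Kn : `|K| / c / e < n%:R.
  by apply: archi_boundP; rewrite !divr_ge0// ltW.
have := bernoulli n (_ : -1 <= e); rewrite /e => /(_ _); rewrite addrCA subrr addr0.
rewrite -/e expr_div_n => /(_ (ltW (lt_trans (ltrN10 R) e0))) nq.
have : K / c >= q ^+ n / m ^+ n.
  by rewrite ler_pdivrMr ?exprn_gt0// mulrAC ler_pdivlMr// mulrC qm.
have : K / c <= `|K| / c by rewrite ler_pM2r ?invr_gt0// ler_norm.
move: Kn; rewrite ltr_pdivrMr//; lra.
Qed.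

Lemma ler_of_radii (q m r : R) k : 0 <= q -> r < 1 ->
  (forall p, r < p -> 0 < p -> p < 1 -> q * p ^+ k <= m) -> q <= m.
Proof.
move=> q0 r1 qm; apply/ler_addgt0Pr => e e0.
(* With [p = 1 - d], the first bound gives [r < p], the second [0 < p], and the third makes the loss
   [q * k%:R * d] in Bernoulli's inequality at most [e]. *)
pose d := Num.min (Num.min ((1 - r) / 2) (1/2)) (e / (q * k%:R + 1)).
have qk : 0 < q * k%:R + 1 by rewrite ltr_wpDl// mulr_ge0.
have [d0 [d1 [d2 d3]]] : 0 < d /\ d <= (1 - r) / 2 /\ d <= 1/2 /\ d <=
    e / (q * k%:R + 1).
  split; last by rewrite /d !ge_min !lexx ?orbT.
  by rewrite /d !lt_min !divr_gt0 ?subr_gt0.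
have := qm (1 - d); rewrite -[1 - d]/(1 + - d).
have := @bernoulli (- d) k; rewrite ler_pdivlMr// in d3.
move=> bk /(_ _ _ _) qd.
have {}bk : 1 + k%:R * - d <= (1 + - d) ^+ k by apply: bk; lra.
have {}qd : q * (1 + - d) ^+ k <= m by apply: qd; lra.
have : q * (1 + k%:R * - d) <= q * (1 + - d) ^+ k by apply: ler_wpM2l.
nra.
Qed.

End Schwarz.

(** * The Cayley transform *)

Section SchwarzLemma.
Variable R : realType.
Local Notation C := (R[i]^o).

(** An involution that exchanges the unit disc and the right half-plane. *)
Definition cayley (w : C) : C := (1 - w) / (1 + w).

Lemma cayleyK (z : C) : 1 + z != 0 -> cayley (cayley z) = z.
Proof.
move=> z1; have n2 : (2 : C) != 0 by rewrite (pnatr_eq0 R[i]).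
have e1 : 1 + cayley z = 2 / (1 + z) by rewrite /cayley; field.
have e2 : 1 - cayley z = 2 * z / (1 + z) by rewrite /cayley; field.
by rewrite {1}/cayley e1 e2; field; rewrite z1.
Qed.

Lemma cayley_den_neq0 (u v : R) : 0 < u -> (1 : C) + (u +i* v) != 0.
Proof.
move=> u0; apply/eqP => -[/eqP]; rewrite addr_eq0 => /eqP h _.
by move: u0; rewrite -[u]opprK -h; lra.
Qed.

Lemma sqr_rnorm_cayley (u v : R) : (1 : C) + (u +i* v) != 0 ->
  rnorm (cayley (u +i* v)) ^+ 2 * ((1 + u) ^+ 2 + v ^+ 2) = (1 - u) ^+ 2 + v ^+ 2.
Proof.
move=> h; have e : (1 + u) ^+ 2 + v ^+ 2 = rnorm ((1 : C) + (u +i* v)) ^+ 2.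
  by rewrite sqr_rnorm/= add0r.
have -> : (1 - u) ^+ 2 + v ^+ 2 = rnorm ((1 : C) - (u +i* v)) ^+ 2.
  by rewrite sqr_rnorm/= sub0r sqrrN.
rewrite e -exprMn -rnormM; congr (rnorm _ ^+ 2).
by rewrite /cayley mulfVK.
Qed.

Lemma rnorm_cayley_lt1 (u v : R) : 0 < u -> rnorm (cayley (u +i* v)) < 1.
Proof.
move=> u0; have := sqr_rnorm_cayley (cayley_den_neq0 v u0).
have x0 := rnorm_ge0 (cayley (u +i* v)).
move: (rnorm _) x0 => x x0 h; rewrite ltNge; apply/negP => x1.
have : 0 <= (x ^+ 2 - 1) * ((1 + u) ^+ 2 + v ^+ 2).
  by apply: mulr_ge0; [rewrite subr_ge0 exprn_ege1|rewrite addr_ge0// sqr_ge0].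
nra.
Qed.

Lemma differentiable_cayley (w : C) : 1 + w != 0 -> differentiable cayley w.
Proof. by move=> w1; apply: differentiable_cdiv. Qed.

(* The Cayley transform maps the disc of centre 0 and radius [p] onto the disc of
   centre [c] and radius [r]; a square circumscribed to the latter stays in the
   right half-plane, which is the image of the unit disc. *)
Lemma rnorm_cayley_ge (p u v : R) : 0 < p < 1 -> (1 : C) + (u +i* v) != 0 ->
  let c := (1 + p ^+ 2) / (1 - p ^+ 2) in let r := 2 * p / (1 - p ^+ 2) in
  (p <= rnorm (cayley (u +i* v))) = (r ^+ 2 <= (u - c) ^+ 2 + v ^+ 2).
Proof.
move=> /andP[p0 p1] w1 c r; have p2 : 0 < 1 - p ^+ 2.
  by rewrite subr_gt0 exprn_ilt1// ltW.
have x0 := rnorm_ge0 (cayley (u +i* v)).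
have := sqr_rnorm_cayley w1; move: (rnorm (cayley _)) x0 => x x0 xE.
have D0 : 0 < (1 + u) ^+ 2 + v ^+ 2.
  have -> : (1 + u) ^+ 2 + v ^+ 2 = rnorm ((1 : C) + (u +i* v)) ^+ 2.
    by rewrite sqr_rnorm/= add0r.
  by rewrite exprn_gt0// rnorm_gt0.
rewrite -(@ler_pXn2r _ 2)// ?nnegrE ?(ltW p0)// -subr_ge0 -[RHS]subr_ge0.
rewrite -(pmulr_lge0 _ D0) -[RHS](pmulr_lge0 _ p2); congr (0 <= _).
by rewrite mulrBl xE /c /r; field; rewrite gt_eqF.
Qed.

End SchwarzLemma.

(** * The sharp Schwarz lemma for zeros of order k *)

Section SchwarzTheorem.
Variable R : realType.
Local Notation C := (R[i]^o).

(* The factor [w ^+ 2] removes the singularity at 0; letting [m] go to infinity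
   removes both this factor and the constant of [cauchy_bound]. *)
Lemma differentiable_power_quotient (g : C -> C) (k m : nat) (A d : R) (z : C) :
  differentiable g z -> 0 < d ->
  (forall h, rnorm h < d -> rnorm (g h) <= A * rnorm h ^+ k) ->
  differentiable (fun w => (g w / w ^+ k) ^+ m * w ^+ 2 : C) z.
Proof.
move=> dg d0 gA; have [->|z0] := eqVneq z 0; last first.
  apply: (@differentiableM _ _ (fun w => (g w / w ^+ k) ^+ m : C) (fun w => w ^+ 2 :
      C)).
    apply: differentiable_cX; apply: differentiable_cdiv => //;
        last by rewrite expf_neq0.
    by apply: differentiable_cX; exact: differentiable_cid.
  by apply: differentiable_cX; exact: differentiable_cid.
apply: (@differentiable_quadratic _ _ _ _ _ (`|A| ^+ m) d) => //.
  by rewrite [0 ^+ 2]expr0n/= mulr0.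
move=> h hd; rewrite add0r; have [->|h0] := eqVneq h 0.
  by rewrite [0 ^+ 2]expr0n/= mulr0 rnorm0 mulr_ge0// exprn_ge0.
rewrite rnormM rnormX rnormM rnormV !rnormX; apply: ler_wpM2r.
  by rewrite exprn_ge0// rnorm_ge0.
have q0 : 0 <= rnorm (g h) / rnorm h ^+ k.
  by rewrite divr_ge0 ?exprn_ge0 ?rnorm_ge0.
rewrite lerXn2r ?nnegrE// ler_pdivrMr ?exprn_gt0 ?rnorm_gt0//.
apply: (le_trans (gA _ hd)); apply: ler_wpM2r (ler_norm _).
by rewrite exprn_ge0// rnorm_ge0.
Qed.

(** For [rnorm z < p < 1], [cauchy_bound] is applied to [Phi], read through the Cayley transform, on
    a square around the image of the disc of radius [p]. Powers give
    [rnorm (g z) / rnorm z ^+ k <= M / p ^+ k], and then [p] tends to 1. The constant [A] only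
    certifies the order of vanishing and leaves no trace in the conclusion. *)
Theorem schwarz (g : C -> C) (k : nat) (M A d : R) : 0 < M -> 0 < d ->
  (forall z, rnorm z < 1 -> differentiable g z) ->
  (forall z, rnorm z < 1 -> rnorm (g z) <= M) ->
  (forall z, rnorm z < d -> rnorm (g z) <= A * rnorm z ^+ k) ->
  forall z, rnorm z < 1 -> rnorm (g z) <= M * rnorm z ^+ k.
Proof.
move=> M0 d0 dg gM gA z z1; have [->|z0] := eqVneq z 0.
  have := gA 0; rewrite rnorm0 => /(_ d0); case: k {gA} => [|k] h.
    by rewrite expr0 mulr1 gM// rnorm0 ltr01.
  by move: h; rewrite expr0n/= !mulr0.
have rz0 := rnorm_gt0 z0; have zk0 : 0 < rnorm z ^+ k by rewrite exprn_gt0.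
apply: (ler_of_radii (k := k) (rnorm_ge0 _) z1) => p zp p0 p1.
have pk0 : 0 < p ^+ k by rewrite exprn_gt0.
rewrite -ler_pdivlMr// mulrAC -ler_pdivrMr//.
have p2 : 0 < 1 - p ^+ 2 by rewrite subr_gt0 exprn_ilt1// ltW.
pose c := (1 + p ^+ 2) / (1 - p ^+ 2); pose r := 2 * p / (1 - p ^+ 2).
have r0 : 0 < r by rewrite divr_gt0// mulr_gt0.
(* This is (1 - p)^2 > 0, and it keeps the left side of the square in the right half-plane. *)
have rc : r < c by rewrite /r /c ltr_pM2r ?invr_gt0//;
    have : 0 < (1 - p) ^+ 2 by [rewrite exprn_gt0// subr_gt0]; nra.
pose a : C := (c - r) +i* (- r); pose l := 2 * r.
have l0 : 0 < l by rewrite mulr_gt0.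
have ptE (s t : R) : a + (s +i* t) * l%:C = (c - r + s * l) +i* (- r + t * l).
  by apply/eqP; rewrite eq_complex/= !mulr0 subr0 add0r !eqxx.
have z1N : 1 + z != 0.
  apply/eqP => /eqP; rewrite addrC addr_eq0 => /eqP zE.
  by move: z1; rewrite zE rnormN rnorm1 ltxx.
case wE : (cayley z) => [u0 v0].
have w1 : (1 : C) + (u0 +i* v0) != 0.
  have n2 : (2 : C) != 0 by rewrite (pnatr_eq0 R[i]).
  have -> : (1 : C) + (u0 +i* v0) = 2 / (1 + z) by rewrite -wE /cayley; field.
  by rewrite mulf_neq0// invr_eq0.
have czE : cayley (u0 +i* v0) = z by rewrite -wE cayleyK.
have in_disc : (u0 - c) ^+ 2 + v0 ^+ 2 < r ^+ 2.
  by rewrite ltNge -rnorm_cayley_ge ?p0// czE -ltNge.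
pose s0 := (u0 - (c - r)) / l; pose t0 := (v0 + r) / l.
have w0E : a + (s0 +i* t0) * l%:C = u0 +i* v0.
  by rewrite ptE /s0 /t0 !divfK ?gt_eqF// addrC subrK addrC addrK.
have s01 : 0 < s0 < 1.
  rewrite /s0 divr_gt0 ?ltr_pdivrMr//=; first by rewrite mul1r /l; nra.
  have := sqr_ge0 v0; nra.
have t01 : 0 < t0 < 1.
  rewrite /t0 divr_gt0 ?ltr_pdivrMr//=; first by rewrite mul1r /l;
      have := sqr_ge0 (u0 - c); nra.
  have := sqr_ge0 (u0 - c); nra.
have [K K0 KP] := cauchy_bound a l0 s01 t01.
(* [K] was fixed before the power [m]; [rnorm z ^+ 2] is what the factor [w ^+ 2] of [Phi]
   contributes at [z]. *)
apply: (@ler_of_powers _ (rnorm z ^+ 2) K);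
    rewrite ?exprn_gt0 ?divr_ge0 ?(ltW M0) ?(ltW pk0)// => m.
pose Phi w : C := (g w / w ^+ k) ^+ m * w ^+ 2.
have re_gt0 (s : R) : 0 <= s <= 1 -> 0 < c - r + s * l.
  by move=> /andP[s_0 _]; rewrite ltr_wpDr ?subr_gt0// mulr_ge0// ltW.
have -> : rnorm z ^+ 2 * (rnorm (g z) / rnorm z ^+ k) ^+ m =
    rnorm (Phi (cayley (a + (s0 +i* t0) * l%:C))).
  by rewrite w0E czE /Phi rnormM rnormX rnormM rnormV !rnormX mulrC.
refine (KP (Phi \o @cayley R) ((M / p ^+ k) ^+ m) _ _ _).
- by rewrite exprn_gt0// divr_gt0.
- move=> s t s1 t1; rewrite ptE.
  apply: differentiable_comp;
      first exact: differentiable_cayley (cayley_den_neq0 _ (re_gt0 _ s1)).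
  by apply: differentiable_power_quotient d0 gA; apply: dg;
      exact: rnorm_cayley_lt1 (re_gt0 _ s1).
move=> s t s1 t1 st; rewrite ptE /=.
set w := cayley _; have w_lt1 : rnorm w < 1 by exact: rnorm_cayley_lt1 (re_gt0 _ s1).
(* The sides of a circumscribed square lie outside the open disc, so they correspond to points of
   modulus at least [p]. *)
have pw : p <= rnorm w.
  rewrite rnorm_cayley_ge ?p0//; last exact: cayley_den_neq0 (re_gt0 _ s1).
  case/or4P: st => /eqP ->; rewrite -/c -/r.
  - rewrite mul0r addr0; have -> : (c - r - c) ^+ 2 = r ^+ 2 by ring.
    by rewrite lerDl sqr_ge0.
  - have -> : (c - r + 1 * l - c) ^+ 2 = r ^+ 2 by rewrite /l; ring.
    by rewrite lerDl sqr_ge0.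
  - by rewrite mul0r addr0 sqrrN lerDr sqr_ge0.
  - have -> : (- r + 1 * l) ^+ 2 = r ^+ 2 by rewrite /l; ring.
    by rewrite lerDr sqr_ge0.
have rw0 : 0 < rnorm w by exact: lt_le_trans pw.
rewrite /Phi rnormM rnormX rnormM rnormV !rnormX.
rewrite -[leRHS]mulr1; apply: ler_pM.
- by rewrite exprn_ge0// divr_ge0 ?exprn_ge0 ?rnorm_ge0.
- by rewrite exprn_ge0// rnorm_ge0.
- rewrite lerXn2r ?nnegrE ?divr_ge0 ?exprn_ge0 ?rnorm_ge0 ?(ltW M0) ?(ltW p0)//.
  apply: ler_pM; rewrite ?rnorm_ge0 ?invr_ge0 ?exprn_ge0 ?rnorm_ge0 ?gM//.
  by rewrite lef_pV2 ?posrE ?exprn_gt0// lerXn2r ?nnegrE ?(ltW p0) ?(ltW rw0).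
by rewrite exprn_ile1 ?rnorm_ge0 ?(ltW w_lt1).
Qed.

End SchwarzTheorem.

(** * Schwarz lemmas on other radii and for a vanishing derivative *)

Section SchwarzVariants.
Variable R : realType.
Local Notation C := (R[i]^o).

Lemma differentiable_caffine (b c z : C) : differentiable (fun w => b + c * w : C) z.
Proof.
apply: differentiableD; first exact: differentiable_cst.
by apply: (@differentiableM _ _ (cst c) (fun w => w : C)) => //;
    exact: differentiable_cst.
Qed.

Lemma schwarz_radius (g : C -> C) (k : nat) (r M A d : R) :
  0 < r -> 0 < M -> 0 < d ->
  (forall z, rnorm z < r -> differentiable g z) ->
  (forall z, rnorm z < r -> rnorm (g z) <= M) ->
  (forall z, rnorm z < d -> rnorm (g z) <= A * rnorm z ^+ k) ->
  forall z, rnorm z < r -> rnorm (g z) <= M * (rnorm z / r) ^+ k.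
Proof.
move=> r0 M0 d0 dg gM gA z zr; have rN : r != 0 by rewrite gt_eqF.
have rC : (r%:C : C) != 0 by rewrite (inj_eq (@complexI R)).
have rr : rnorm (r%:C : C) = r by rewrite rnorm_real gtr0_norm.
pose phi (w : C) : C := 0 + r%:C * w.
have phiE w : rnorm (phi w) = r * rnorm w by rewrite /phi add0r rnormM rr.
have lt_phi w e : rnorm w < e / r -> rnorm (phi w) < e.
  by rewrite phiE [r * _]mulrC -ltr_pdivlMr.
have lt1 w : rnorm w < 1 -> rnorm (phi w) < r.
  by move=> w1; apply: lt_phi; rewrite divff.
have := @schwarz R (g \o phi) k M (A * r ^+ k) (d / r) M0 (divr_gt0 d0 r0).
move=> /(_ _ _ _ (z / r%:C)) /=.
have -> : phi (z / r%:C) = z by rewrite /phi add0r mulrC divfK.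
rewrite rnormM rnormV rr ltr_pdivrMr// mul1r; apply; last exact: zr.
- move=> w /lt1 w1; apply: differentiable_comp; last exact: dg.
  exact: differentiable_caffine.
- by move=> w /lt1/gM.
by move=> w /lt_phi/gA/le_trans; apply; rewrite phiE exprMn mulrA.
Qed.

Lemma schwarz1 (g : C -> C) (r M : R) : 0 < r -> 0 < M -> g 0 = 0 ->
  (forall z, rnorm z < r -> differentiable g z) ->
  (forall z, rnorm z < r -> rnorm (g z) <= M) ->
  forall z, rnorm z < r -> rnorm (g z) <= M * (rnorm z / r).
Proof.
move=> r0 M0 g0 dg gM z zr.
have dg0 : differentiable g 0 by apply: dg; rewrite rnorm0.
have [A [d [A0 d0 dA]]] := differentiable_lip dg0.
rewrite -[_ / r]expr1; apply: (schwarz_radius (A := A) r0 M0 d0) => // w /dA.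
by rewrite add0r g0 subr0 expr1.
Qed.

(** A zero derivative gives o(z), but [schwarz] asks for O(z^2). The gap is closed by showing that
    [g] is almost additive under doubling, g (2 h) = 2 g h + O(h^2), and by iterating this down to
    0. *)
Lemma schwarz2 (g : C -> C) (M : R) : 0 < M -> g 0 = 0 ->
  (forall z, rnorm z < 1 -> differentiable g z) ->
  (forall z, rnorm z < 1 -> rnorm (g z) <= M) ->
  (forall e : R, 0 < e -> exists2 d : R, 0 < d &
    forall z, rnorm z < d -> rnorm (g z) <= e * rnorm z) ->
  forall z, rnorm z < 1 -> rnorm (g z) <= M * rnorm z ^+ 2.
Proof.
move=> M0 g0 dg gM go.
have h2 : (0 : R) < 1/2 by rewrite divr_gt0.
have lt1 (y z : C) : rnorm y < 1/2 -> rnorm z < 1/2 -> rnorm (y + z) < 1.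
  by move=> y2 z2; apply: (le_lt_trans (rnormD _ _)); lra.
have dgD (y z : C) : rnorm y < 1/2 -> rnorm z < 1/2 ->
    differentiable (fun w => g (y + w)) z.
  move=> y2 z2; apply: (@differentiable_comp _ _ _ _ (fun w => y + w : C) g);
      last exact: dg (lt1 _ _ y2 z2).
  by apply: differentiableD => //; exact: differentiable_cst.
have half_lt1 (z : C) : rnorm z < 1/2 -> rnorm z < 1 by move=> ?; lra.
have lipg (y z : C) : rnorm y < 1/2 -> rnorm z < 1/2 ->
    rnorm (g (y + z) - g y) <= 4 * M * rnorm z.
  move=> y2 z2.
  have -> : 4 * M * rnorm z = 2 * M * (rnorm z / (1/2)) by field.
  apply: (schwarz1 (g := fun w => g (y + w) - g y)); last exact: z2.
  - exact: h2.
  - by rewrite mulr_gt0.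
  - by rewrite addr0 subrr.
  - by move=> w w2; apply: differentiable_csub; exact: dgD.
  move=> w w2; apply: (le_trans (rnormBD _ _)).
  have := gM _ (lt1 _ _ y2 w2); have := gM _ (half_lt1 _ y2); lra.
(* The map w |-> g (h + w) - g w - g h vanishes at 0 and is at most [5 * M * rnorm h] on the disc of
   radius 1/2: 4 from [lipg] and 1 from [schwarz1]. Evaluation at w = h gains [2 * rnorm h]. *)
have gdouble (h : C) : rnorm h < 1/2 -> rnorm (g (h + h) - 2 * g h) <=
    10 * M * rnorm h ^+ 2.
  move=> hh; have [->|h0] := eqVneq h 0.
    by rewrite addr0 g0 mulr0 subr0 rnorm0 expr0n/= mulr0.
  have rh := rnorm_gt0 h0.
  have -> : 10 * M * rnorm h ^+ 2 = 5 * M * rnorm h * (rnorm h / (1/2)) by field.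
  have -> : g (h + h) - 2 * g h = g (h + h) - g h - g h by ring.
  apply: (schwarz1 (g := fun w => g (h + w) - g w - g h)); last exact: hh.
  - exact: h2.
  - by rewrite !mulr_gt0.
  - by rewrite addr0 g0 subr0 subrr.
  - move=> w w2; apply: differentiable_csub; apply: differentiableB; first exact: dgD.
    exact: dg (half_lt1 _ w2).
  move=> w w2; apply: (le_trans (rnormBD _ _)).
  have := lipg _ _ w2 hh; rewrite (addrC w).
  have := schwarz1 ltr01 M0 g0 dg gM (half_lt1 _ hh); rewrite divr1; lra.
have half (z : C) : z / 2 + z / 2 = z by field.
(* The doubling errors sum as a geometric series, whose partial sums produce the factor
   [1 - (2 ^+ n)^-1]. *)
have gdyadic (z : C) n : rnorm z < 1 ->
    rnorm (g z - 2 ^+ n * g (z / 2 ^+ n)) <= 5 * M * rnorm z ^+ 2 * (1 - (2 ^+ n)^-1).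
  move=> z1; elim: n => [|n ih].
    by rewrite !expr0 divr1 mul1r invr1 !subrr rnorm0 mulr0.
  have n2 : 0 < (2 ^+ n : R) by rewrite exprn_gt0.
  have n21 : 1 <= (2 ^+ n : R) by rewrite exprn_ege1// ler1n.
  have rw : rnorm (z / 2 ^+ n.+1) = rnorm z / 2 ^+ n.+1
      by rewrite rnormM rnormV rnormX rnorm_nat.
  have := gdouble (z / 2 ^+ n.+1); rewrite rw.
  have -> : z / 2 ^+ n.+1 + z / 2 ^+ n.+1 = z / 2 ^+ n.
    by rewrite exprSr invfM mulrA half.
  have z0 := rnorm_ge0 z.
  move=> /(_ _); have -> : rnorm z / 2 ^+ n.+1 < 1/2.
    by rewrite ltr_pdivrMr ?exprn_gt0// exprS mulrA divfK// mul1r;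
        exact: lt_le_trans n21.
  move=> /(_ isT) gd.
  have -> : g z - 2 ^+ n.+1 * g (z / 2 ^+ n.+1) = g z - 2 ^+ n * g (z / 2 ^+ n) +
     2 ^+ n * (g (z / 2 ^+ n) - 2 * g (z / 2 ^+ n.+1)) by rewrite exprS; ring.
  apply: (le_trans (rnormD _ _)); rewrite [X in _ + X]rnormM rnormX rnorm_nat.
  have -> : 5 * M * rnorm z ^+ 2 * (1 - (2 ^+ n.+1)^-1) =
     5 * M * rnorm z ^+ 2 * (1 - (2 ^+ n)^-1) +
     2 ^+ n * (10 * M * (rnorm z / 2 ^+ n.+1) ^+ 2).
    by rewrite [2 ^+ n.+1]exprS; field; rewrite gt_eqF.
  by apply: lerD => //; apply: ler_wpM2l => //; exact: ltW.
(* The remaining term [2 ^+ n * g (z / 2 ^+ n)] tends to 0 by the little-o hypothesis, which leaves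
   the quadratic bound [5 * M]; [schwarz] sharpens it to [M]. *)
apply: (schwarz (A := 5 * M) M0 ltr01) => // z z1.
apply/ler_addgt0Pr => e e0; have [d d0 dP] := go e e0.
have [n nd] : exists n, rnorm z / 2 ^+ n < d.
  exists (Num.bound (1 / d)); rewrite ltr_pdivrMr ?exprn_gt0//.
  have : 1 / d < 2 ^+ Num.bound (1 / d).
    apply: lt_trans (archi_boundP _) _; first by rewrite divr_ge0// ltW.
    by rewrite -natrX ltr_nat ltn_expl.
  by rewrite ltr_pdivrMr// mulrC; apply: lt_trans.
have n2 : 0 < (2 ^+ n : R) by rewrite exprn_gt0.
have rw : rnorm (z / 2 ^+ n) = rnorm z / 2 ^+ n
    by rewrite rnormM rnormV rnormX rnorm_nat.
have -> : g z = (g z - 2 ^+ n * g (z / 2 ^+ n)) + 2 ^+ n * g (z / 2 ^+ n)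
    by rewrite subrK.
apply: (le_trans (rnormD _ _)); apply: lerD.
  apply: (le_trans (gdyadic _ _ z1)); apply: ler_piMr.
    by rewrite !mulr_ge0 ?exprn_ge0 ?rnorm_ge0// ltW.
  by rewrite gerBl invr_ge0 ltW.
rewrite rnormM rnormX rnorm_nat; have := dP (z / 2 ^+ n); rewrite rw => /(_ nd) h.
apply: (@le_trans _ _ (2 ^+ n * (e * (rnorm z / 2 ^+ n)))).
  by rewrite ler_pM2l.
have -> : 2 ^+ n * (e * (rnorm z / 2 ^+ n)) = e * rnorm z by field; rewrite gt_eqF.
by rewrite ler_piMr// ltW.
Qed.

End SchwarzVariants.

(** * The complex Hahn-Banach theorem *)

Section HahnBanach.
Variables (R : realType) (E : normedModType R[i]) (v : E).
Local Notation C := (R[i]^o).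

(** A partial real functional is encoded by its graph. Single-valuedness follows from [dominated],
    applied to differences (0, a - b) in both orders. *)
Let real_linear (A : set (E * R)) := forall (t : R) p q, A p -> A q ->
  A (t%:C *: p.1 + q.1, t * p.2 + q.2).

Let dominated (A : set (E * R)) := forall p, A p -> p.2 <= rnorm p.1.

Let extension (A : set (E * R)) :=
  [/\ real_linear A, dominated A & A (v, rnorm v)].

Let extension0 (A : set (E * R)) : extension A -> A (0, 0).
Proof.
by move=> [Al _ Av]; have := Al (-1) _ _ Av Av;
    rewrite /= rmorphN1 scaleN1r mulN1r !addNr.
Qed.

Let extensionZ (A : set (E * R)) (t : R) p :
  extension A -> A p -> A (t%:C *: p.1, t * p.2).
Proof.
move=> eA Ap; have A0 := extension0 eA; have [Al _ _] := eA.
by have := Al t _ _ Ap A0; rewrite /= !addr0.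
Qed.

Let line_extension : extension [set (t%:C *: v, t * rnorm v) | t in [set: R]].
Proof.
split.
- move=> t _ _ [a _ <-] [b _ <-]; exists (t * a + b) => //=.
  by rewrite rmorphD rmorphM/= scalerDl scalerA mulrDl mulrA.
- by move=> _ [t _ <-] /=; rewrite rnormZ rnorm_real ler_wpM2r ?rnorm_ge0 ?ler_norm.
- by exists 1 => //; rewrite scale1r mul1r.
Qed.

(** The value [c] at [x] must lie between all p.2 - |p.1 - x| and all |q.1 + x| - q.2. The triangle
    inequality separates these two families, so a supremum serves. *)
Let extend (A : set (E * R)) (x : E) : extension A ->
  exists B, [/\ extension B, A `<=` B & exists c, B (x, c)].
Proof.
move=> eA; have [Al Ad Av] := eA; have A0 := extension0 eA.
pose S := [set p.2 - rnorm (p.1 - x) | p in A].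
have Sub q : A q -> ubound S (rnorm (q.1 + x) - q.2).
  move=> Aq _ [p Ap <-]; have := Ad _ (Al 1 _ _ Ap Aq); rewrite /= scale1r mul1r.
  have := rnormD (p.1 - x) (q.1 + x); rewrite addrACA addNr addr0; lra.
have S0 : S !=set0 by exists (0 - rnorm (0 - x)), (0, 0).
have hS : has_sup S by split => //; exists (rnorm (0 + x) - 0); exact: (Sub (0, 0)).
pose c := sup S.
have cle q : A q -> c <= rnorm (q.1 + x) - q.2 by move=> /Sub; apply: ge_sup.
have cge p : A p -> p.2 - rnorm (p.1 - x) <= c.
  by move=> Ap; apply: sup_upper_bound => //; exists p.
exists [set (p.1 + t%:C *: x, p.2 + t * c) | p in A & t in [set: R]]; split.
- split.
  + move=> t _ _ [p Ap [a _ <-]] [q Aq [b _ <-]] /=.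
    exists (t%:C *: p.1 + q.1, t * p.2 + q.2); first exact: Al.
    exists (t * a + b) => //=; congr (_, _); last by ring.
    by rewrite rmorphD rmorphM/= scalerDl scalerDr scalerA addrACA.
  + move=> _ [p Ap [t _ <-]] /=.
    have [t0|t0|->] := ltgtP t 0; last by rewrite scale0r mul0r !addr0 Ad.
    * have s0 : 0 < - t by rewrite oppr_gt0.
      have /cge/= := extensionZ (- t)^-1 eA Ap.
      have -> : ((- t)^-1)%:C *: p.1 - x = ((- t)^-1)%:C *: (p.1 + t%:C *: x).
        by rewrite scalerDr scalerA -rmorphM/= invrN mulNr mulVf ?lt_eqF// rmorphN1
            scaleN1r.
      rewrite rnormZ rnorm_real gtr0_norm ?invr_gt0// -mulrBr mulrC ler_pdivrMr//; lra.
    * have /cle/= := extensionZ t^-1 eA Ap.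
      have -> : (t^-1)%:C *: p.1 + x = (t^-1)%:C *: (p.1 + t%:C *: x).
        by rewrite scalerDr scalerA -rmorphM/= mulVf ?gt_eqF// scale1r.
      rewrite rnormZ rnorm_real gtr0_norm ?invr_gt0// -mulrBr mulrC ler_pdivlMr//; lra.
  + exists (v, rnorm v) => //; exists 0 => //=.
    by rewrite scale0r mul0r !addr0.
- by move=> [p1 p2] Ap; exists (p1, p2) => //; exists 0 => //=;
    rewrite scale0r mul0r !addr0.
- by exists c, (0, 0) => //; exists 1 => //=; rewrite scale1r mul1r !add0r.
Qed.

Let total_extension : exists A, extension A /\ forall x, exists c, A (x, c).
Proof.
have [|A [PA Amax]] := @Zorn_bigcup _ [set A : set (E * R) | A = set0 \/ extension A].
  move=> F FP Ftot; have [[X [FX XN]]|F0] := pselect (exists X, F X /\ X <> set0).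
    right; have FE Y : F Y -> Y <> set0 -> extension Y by move=> FY YN; case: (FP Y FY).
    have FEp Y p : F Y -> Y p -> extension Y.
      by move=> FY Yp; apply: FE => // Y0; rewrite Y0 in Yp.
    split.
    - move=> t p q [Y FY Yp] [Z FZ Zq].
      have [YZ|ZY] := Ftot _ _ FY FZ.
        by exists Z => //; have [Zl _ _] := FEp _ _ FZ Zq; apply: Zl => //; exact: YZ.
      by exists Y => //; have [Yl _ _] := FEp _ _ FY Yp; apply: Yl => //; exact: ZY.
    - by move=> p [Y FY Yp]; have [_ Yd _] := FEp _ _ FY Yp; exact: Yd.
    - by exists X => //; have [] := FE _ FX XN.
  left; apply/seteqP; split => // p [Y FY Yp]; apply: F0; exists Y; split => // Y0.
  by rewrite Y0 in Yp.
have eA : extension A.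
  case: PA => // A0; exfalso;
      apply: (Amax [set (t%:C *: v, t * rnorm v) | t in [set: R]]).
    rewrite A0; split => // h; have := h (0%:C *: v, 0 * rnorm v); apply.
    by exists 0.
  by right; exact: line_extension.
exists A; split => // x; have [B [eB AB [c Bc]]] := extend x eA.
have [ABE|NAB] := pselect (A = B); first by exists c; rewrite ABE.
exfalso; apply: (Amax B); last by right.
by split => // BA; apply: NAB; apply/seteqP.
Qed.

Theorem hahn_banach : exists f : {linear E -> C},
  (forall x, rnorm (f x) <= rnorm x) /\ f v = (rnorm v)%:C.
Proof.
have [A [eA /choice[u uA]]] := total_extension; have [Al Ad Av] := eA.
have A_fun x a b : A (x, a) -> A (x, b) -> a = b.
  have le12 a' b' : A (x, a') -> A (x, b') -> a' <= b'.
    move=> Aa Ab; have := Ad _ (Al (-1) _ _ Ab Aa).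
    by rewrite /= rmorphN1 scaleN1r addNr rnorm0 mulN1r addrC subr_le0.
  by move=> Aa Ab; apply/le_anti; rewrite !le12.
have uD (t : R) x y : u (t%:C *: x + y) = t * u x + u y.
  by apply: A_fun (uA _) _; exact: (Al _ (x, u x) (y, u y)).
have uD1 x y : u (x + y) = u x + u y by have := uD 1 x y; rewrite scale1r mul1r.
have u0 : u 0 = 0 by apply: A_fun (uA _) (extension0 eA).
have uZ (t : R) x : u (t%:C *: x) = t * u x by rewrite -[_ *: x]addr0 uD u0 addr0.
have uv : u v = rnorm v by exact: A_fun (uA _) Av.
(* The complex-linear functional whose real part is [u]. *)
pose l x : C := u x +i* (- u ('i *: x)).
have l_lin : linear l.
  move=> [a b] x y; rewrite /l.
  have -> : (a +i* b) *: x = a%:C *: x + b%:C *: ('i *: x).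
    rewrite scalerA -scalerDl; congr (_ *: _); apply/eqP.
    by rewrite eq_complex/= !mulr0 !mul0r mulr1 subrr !addr0 add0r !eqxx.
  rewrite !scalerDr !uD1 uZ uZ !scalerA !(mulrC 'i) -!scalerA uZ uZ.
  have -> : u ('i *: ('i *: x)) = - u x.
    by rewrite scalerA -expr2 sqr_i -(rmorphN1 (real_complex R)) uZ mulN1r.
  apply/eqP; rewrite eq_complex /=; apply/andP; split; apply/eqP; ring.
have l_le x : rnorm (l x) <= rnorm x.
  have [->|l0] := eqVneq (l x) 0; first by rewrite rnorm0 rnorm_ge0.
  have rl := rnorm_gt0 l0.
  (* A rotation by the unimodular [w] makes [l (w *: x)] real, so that the bound on the real part
     [u] bounds the modulus of [l x]. *)
  pose w : C := (l x)^* / (rnorm (l x))%:C.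
  have wl : w * l x = (rnorm (l x))%:C.
    have nl : `|l x : R[i]| = (rnorm (l x))%:C := @normE R C (l x).
    rewrite /w mulrAC [_^* * _]mulrC -sqr_normc nl expr2 mulfK//.
    by rewrite (inj_eq (@complexI R)) gt_eqF.
  have w1 : rnorm w = 1.
    have : rnorm (w * l x) = rnorm (l x) by rewrite wl rnorm_real ger0_norm// ltW.
    by rewrite rnormM => /(canRL (mulfK (lt0r_neq0 rl))); rewrite divff ?lt0r_neq0.
  have lw : l (w *: x) = w * l x.
    by rewrite -[w *: x]addr0 l_lin; have := l_lin 0 0 0;
        rewrite /l scale0r !addr0 scaler0 u0 oppr0 => _; rewrite addr0.
  have : u (w *: x) = rnorm (l x) by have := congr1 (@complex.Re R) lw; rewrite wl.
  by move=> <-; have := Ad _ (uA (w *: x)); rewrite /= rnormZ w1 mul1r.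
pose lM := GRing.isLinear.Build _ _ _ _ _ l_lin.
pose f : {linear E -> C} := HB.pack l lM.
exists f; split => [x|]; first exact: l_le.
(* The real part of [l v] is already [rnorm v], which the modulus cannot exceed, so the imaginary
   part vanishes. *)
have := l_le v; rewrite /= -(@ler_pXn2r _ 2)// ?nnegrE ?rnorm_ge0//.
rewrite sqr_rnorm/= uv gerDl => h.
have /eqP h0 : u ('i *: v) == 0 by rewrite -sqrf_eq0 eq_le sqr_ge0 andbT -sqrrN.
by apply/eqP; rewrite eq_complex/= uv h0 oppr0 !eqxx.
Qed.

End HahnBanach.

(** * Schwarz lemmas in normed spaces *)

Section VectorSchwarz.
Variable R : realType.
Local Notation C := (R[i]^o).
Implicit Types E F : normedModType R[i].

Lemma bounded_continuous E F (f : {linear E -> F}) (K : R) :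
  (forall x, rnorm (f x) <= K * rnorm x) -> continuous f.
Proof.
move=> fK; apply: bounded_linear_continuous; apply/ex_bound; exists (`|K|%:C).
apply/near_rnorm; exists 1 => // x; rewrite subr0 => x1.
rewrite /= normE lecR; apply: (le_trans (fK x)).
apply: (@le_trans _ _ (`|K| * rnorm x)).
  by rewrite ler_wpM2r ?rnorm_ge0 ?ler_norm.
by rewrite ler_piMr// ltW.
Qed.

Lemma norming_functional F (y : F) : exists f : {linear F -> C},
  [/\ continuous f, forall x, rnorm (f x) <= rnorm x & rnorm (f y) = rnorm y].
Proof.
have [f [f1 fy]] := hahn_banach y; exists f; split => //.
  by apply: (@bounded_continuous _ _ _ 1) => x; rewrite mul1r.
by rewrite fy rnorm_real ger0_norm// rnorm_ge0.
Qed.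

Lemma differentiable_functional E F (f : {linear F -> C}) (g : E -> F) x :
  continuous f -> differentiable g x -> differentiable (f \o g) x.
Proof.
by move=> fc dg; exact: differentiable_comp dg (linear_differentiable _ fc).
Qed.

Lemma vschwarz_radius F (g : C -> F) (k : nat) (r M A d : R) :
  0 < r -> 0 < M -> 0 < d ->
  (forall z, rnorm z < r -> differentiable g z) ->
  (forall z, rnorm z < r -> rnorm (g z) <= M) ->
  (forall z, rnorm z < d -> rnorm (g z) <= A * rnorm z ^+ k) ->
  forall z, rnorm z < r -> rnorm (g z) <= M * (rnorm z / r) ^+ k.
Proof.
move=> r0 M0 d0 dg gM gA z zr; have [f [fc f1 <-]] := norming_functional (g z).
apply: (schwarz_radius (g := f \o g) (A := A) r0 M0 d0); last exact: zr.
- by move=> w /dg; exact: differentiable_functional.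
- by move=> w /gM; exact: le_trans (f1 _).
- by move=> w /gA; exact: le_trans (f1 _).
Qed.

Lemma vschwarz1 F (g : C -> F) (r M : R) : 0 < r -> 0 < M -> g 0 = 0 ->
  (forall z, rnorm z < r -> differentiable g z) ->
  (forall z, rnorm z < r -> rnorm (g z) <= M) ->
  forall z, rnorm z < r -> rnorm (g z) <= M * (rnorm z / r).
Proof.
move=> r0 M0 g0 dg gM z zr; have [f [fc f1 <-]] := norming_functional (g z).
apply: (schwarz1 (g := f \o g) r0 M0); last exact: zr.
- by rewrite /= g0 raddf0.
- by move=> w /dg; exact: differentiable_functional.
- by move=> w /gM; exact: le_trans (f1 _).
Qed.

Lemma vschwarz2 F (g : C -> F) (M : R) : 0 < M -> g 0 = 0 ->
  (forall z, rnorm z < 1 -> differentiable g z) ->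
  (forall z, rnorm z < 1 -> rnorm (g z) <= M) ->
  (forall e : R, 0 < e -> exists2 d : R, 0 < d &
    forall z, rnorm z < d -> rnorm (g z) <= e * rnorm z) ->
  forall z, rnorm z < 1 -> rnorm (g z) <= M * rnorm z ^+ 2.
Proof.
move=> M0 g0 dg gM go z zr; have [f [fc f1 <-]] := norming_functional (g z).
apply: (schwarz2 (g := f \o g) M0); last exact: zr.
- by rewrite /= g0 raddf0.
- by move=> w /dg; exact: differentiable_functional.
- by move=> w /gM; exact: le_trans (f1 _).
- move=> e /go[d d0 dP]; exists d => // w /dP; exact: le_trans (f1 _).
Qed.

Lemma differentiable_path E F (g : E -> F) (x v : E) (z : C) :
  differentiable g (x + z *: v) -> differentiable (fun w : C => g (x + w *: v)) z.
Proof.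
move=> dg; apply: (@differentiable_comp _ _ _ _ (fun w : C => x + w *: v) g);
    last exact: dg.
apply: differentiableD; first exact: differentiable_cst.
exact: (@differentiableZl _ _ _ (fun w : C => w) v z).
Qed.

Lemma unit_direction E (x : E) : x != 0 ->
  exists2 u, rnorm u = 1 & x = (rnorm x)%:C *: u.
Proof.
move=> /rnorm_gt0 x0; exists (((rnorm x)^-1)%:C *: x).
  by rewrite rnormZ rnorm_real gtr0_norm ?invr_gt0// mulVf ?gt_eqF.
by rewrite scalerA -rmorphM/= divff ?gt_eqF// scale1r.
Qed.

Lemma ball_schwarz E F (g : E -> F) (k : nat) (M A d : R) : 0 < M -> 0 < d ->
  (forall x, rnorm x < 1 -> differentiable g x) ->
  (forall x, rnorm x < 1 -> rnorm (g x) <= M) ->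
  (forall x, rnorm x < d -> rnorm (g x) <= A * rnorm x ^+ k) ->
  forall x, rnorm x < 1 -> rnorm (g x) <= M * rnorm x ^+ k.
Proof.
move=> M0 d0 dg gM gA x x1; have [->|xN0] := eqVneq x 0.
  rewrite rnorm0; have := gA 0; rewrite rnorm0 => /(_ d0).
  case: k {gA} => [|k] h; first by rewrite expr0 mulr1 gM// rnorm0.
  by move: h; rewrite expr0n/= !mulr0.
have [u u1 xE] := unit_direction xN0.
(* The map is restricted to the complex line through [x]; the summand 0 matches the shape of
   [differentiable_path]. *)
have uz (z : C) : rnorm (0 + z *: u) = rnorm z by rewrite add0r rnormZ u1 mulr1.
have xE0 : 0 + (rnorm x)%:C *: u = x by rewrite add0r.
have rx : rnorm ((rnorm x)%:C : C) = rnorm x by rewrite rnorm_real ger0_norm ?rnorm_ge0.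
have := vschwarz_radius (g := fun z : C => g (0 + z *:
    u)) (k := k) (A := A) ltr01 M0 d0.
move=> /(_ _ _ _ (rnorm x)%:C); rewrite rx divr1 xE0; apply; last exact: x1.
- by move=> z; rewrite -uz => /dg; exact: differentiable_path.
- by move=> z; rewrite -uz => /gM.
- by move=> z; rewrite -uz => /gA.
Qed.

Lemma ball_schwarz1 E F (g : E -> F) (M : R) : 0 < M -> g 0 = 0 ->
  (forall x, rnorm x < 1 -> differentiable g x) ->
  (forall x, rnorm x < 1 -> rnorm (g x) <= M) ->
  forall x, rnorm x < 1 -> rnorm (g x) <= M * rnorm x.
Proof.
move=> M0 g0 dg gM x x1; have dg0 : differentiable g 0 by apply: dg; rewrite rnorm0.
have [A [d [A0 d0 dA]]] := differentiable_lip dg0.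
rewrite -[rnorm x in leRHS]expr1; apply: (ball_schwarz (A := A) M0 d0 dg gM) x1.
by move=> y /dA; rewrite add0r g0 subr0 expr1.
Qed.

Lemma ball_schwarz2 E F (g : E -> F) (M : R) : 0 < M -> g 0 = 0 ->
  (forall x, rnorm x < 1 -> differentiable g x) ->
  (forall x, rnorm x < 1 -> rnorm (g x) <= M) ->
  (forall e : R, 0 < e -> exists2 d : R, 0 < d &
    forall x, rnorm x < d -> rnorm (g x) <= e * rnorm x) ->
  forall x, rnorm x < 1 -> rnorm (g x) <= M * rnorm x ^+ 2.
Proof.
move=> M0 g0 dg gM go x x1; have [->|xN0] := eqVneq x 0.
  by rewrite g0 !rnorm0 expr0n/= mulr0.
have [u u1 xE] := unit_direction xN0.
have uz (z : C) : rnorm (0 + z *: u) = rnorm z by rewrite add0r rnormZ u1 mulr1.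
have xE0 : 0 + (rnorm x)%:C *: u = x by rewrite add0r.
have rx : rnorm ((rnorm x)%:C : C) = rnorm x by rewrite rnorm_real ger0_norm ?rnorm_ge0.
have := vschwarz2 (g := fun z : C => g (0 + z *: u)) M0.
move=> /(_ _ _ _ _ (rnorm x)%:C); rewrite rx xE0; apply; last exact: x1.
- by rewrite scale0r addr0.
- by move=> z; rewrite -uz => /dg; exact: differentiable_path.
- by move=> z; rewrite -uz => /gM.
- by move=> e /go[d d0 dP]; exists d => // z; rewrite -uz => /dP.
Qed.

End VectorSchwarz.

(** * Cartan's uniqueness theorem *)

Section CartanUniqueness.
Variables (R : realType) (E : normedModType R[i]) (h : E -> E).
Local Notation C := (R[i]^o).
Hypothesis h_diff : forall x, rnorm x < 1 -> differentiable h x.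
Hypothesis h_ball : forall x, rnorm x < 1 -> rnorm (h x) < 1.
Hypothesis h0 : h 0 = 0.
Hypothesis dh0 : forall v, 'd h 0 v = v.

Let D x := h x - x.

Let D_diff x : rnorm x < 1 -> differentiable D x.
Proof. by move=> x1; apply: differentiableB; [exact: h_diff|exact: ex_diff]. Qed.

Let D_le2 x : rnorm x < 1 -> rnorm (D x) <= 2.
Proof. by move=> x1; apply: (le_trans (rnormBD _ _)); have := h_ball x1; lra. Qed.

Let D0 : D 0 = 0.
Proof. by rewrite /D h0 subr0. Qed.

Let D_quadratic x : rnorm x < 1 -> rnorm (D x) <= 2 * rnorm x ^+ 2.
Proof.
apply: (ball_schwarz2 (ltr0n R 2) D0 D_diff D_le2) => e e0.
have dh : differentiable h 0 by apply: h_diff; rewrite rnorm0.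
have [d d0 dP] := diff_rnorm dh e0.
by exists d => // y /dP; rewrite add0r h0 subr0 dh0.
Qed.

Let T n := iter n h.

Let T_ball n x : rnorm x < 1 -> rnorm (T n x) < 1.
Proof. by move=> x1; elim: n => [//|n ih] /=; exact: h_ball. Qed.

Let T_diff n x : rnorm x < 1 -> differentiable (T n) x.
Proof.
move=> x1; elim: n => [|n ih]; first exact: ex_diff.
by apply: (@differentiable_comp _ _ _ _ (T n) h) => //; exact: h_diff (T_ball n x1).
Qed.

Let T0 n : T n 0 = 0.
Proof. by elim: n => [//|n ih]; rewrite /T iterS -/(T n) ih h0. Qed.

Let T_contract n x : rnorm x < 1 -> rnorm (T n x) <= rnorm x.
Proof.
rewrite -[leRHS]mul1r; apply: (ball_schwarz1 ltr01 (T0 n)) => y y1.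
  exact: T_diff.
exact: ltW (T_ball n y1).
Qed.

(** Telescoping along the orbit gives the constant [2 * n%:R], which is good enough to certify
    vanishing of order [k]. Since [T n y - y] is bounded by 2 on the ball, [ball_schwarz] turns the
    constant into 2, uniformly in [n]. *)
Let T_sub_le k n x : (forall y, rnorm y < 1 -> rnorm (D y) <= 2 * rnorm y ^+ k) ->
  rnorm x < 1 -> rnorm (T n x - x) <= 2 * rnorm x ^+ k.
Proof.
move=> DP; apply: (ball_schwarz (g := fun y => T n y - y) (A := 2 * n%:R) (ltr0n R 2)
    ltr01).
- by move=> y y1; apply: differentiableB; [exact: T_diff|exact: ex_diff].
- by move=> y y1; apply: (le_trans (rnormBD _ _)); have := T_ball n y1; lra.
move=> y y1; elim: n => [|n ih]; first by rewrite subrr rnorm0 mulr0 mul0r.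
have -> : T n.+1 y - y = D (T n y) + (T n y - y) by rewrite /D addrA subrK.
apply: (le_trans (rnormD _ _)); rewrite -(natr1 n) mulrDr mulrDl mulr1 addrC.
apply: lerD => //; apply: (le_trans (DP _ (T_ball n y1))).
by rewrite ler_pM2l// lerXn2r ?nnegrE ?rnorm_ge0 ?T_contract.
Qed.

(** Schwarz lemma in the direction [v]: on the disc of radius [rnorm x / rnorm v] the points
    [x + z *: v] stay in the ball of radius [2 * rnorm x], where [D] is O(|x|^k). Evaluation at z =
    1 gains [rnorm v / rnorm x], which is at most [2 * rnorm x]. *)
Let D_lip k x v : (forall y, rnorm y < 1 -> rnorm (D y) <= 2 * rnorm y ^+ k) ->
  rnorm x < 1/4 -> rnorm v <= 2 * rnorm x ^+ 2 ->
  rnorm (D (x + v) - D x) <= 8 * 2 ^+ k * rnorm x ^+ k.+1.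
Proof.
move=> DP x4 vx; have x_ge0 := rnorm_ge0 x.
have [->|vN0] := eqVneq v 0.
  by rewrite addr0 subrr rnorm0 !mulr_ge0// ?exprn_ge0.
have v0 := rnorm_gt0 vN0.
have x0 : 0 < rnorm x.
  rewrite lt_neqAle x_ge0 andbT; apply/negP => /eqP xE.
  by move: vx; rewrite -xE expr0n/= mulr0; lra.
pose r := rnorm x / rnorm v; have r0 : 0 < r by rewrite divr_gt0.
have zv (z : C) : rnorm z < r -> rnorm (x + z *: v) < 2 * rnorm x.
  rewrite /r ltr_pdivlMr// -rnormZ => zr; apply: (le_lt_trans (rnormD _ _)); lra.
have zv1 (z : C) : rnorm z < r -> rnorm (x + z *: v) < 1 by move=> /zv; lra.
have M0 : 0 < 4 * (2 ^+ k * rnorm x ^+ k) by rewrite !mulr_gt0 ?exprn_gt0.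
have := vschwarz1 (g := fun z : C => D (x + z *: v) - D x) r0 M0.
move=> /(_ _ _ _ 1); rewrite scale1r rnorm1 => lip.
apply: (le_trans (lip _ _ _ _)).
- by rewrite scale0r addr0 subrr.
- move=> z /zv1 z1; apply: differentiableB; last exact: differentiable_cst.
  by apply: differentiable_path; exact: D_diff.
- move=> z zr; apply: (le_trans (rnormBD _ _)); rewrite -exprMn.
  have h1 := DP _ (zv1 _ zr).
  have h2 : rnorm (x + z *: v) ^+ k <= (2 * rnorm x) ^+ k.
    by rewrite lerXn2r ?nnegrE ?rnorm_ge0 ?mulr_ge0// ltW// zv.
  have h3 : rnorm (D x) <= 2 * rnorm x ^+ k by apply: DP; lra.
  have h4 : rnorm x ^+ k <= (2 * rnorm x) ^+ k.
    by rewrite lerXn2r ?nnegrE ?rnorm_ge0 ?mulr_ge0//; lra.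
  lra.
- rewrite /r ltr_pdivlMr// mul1r; apply: (le_lt_trans vx); nra.
have -> : 8 * 2 ^+ k * rnorm x ^+ k.+1 = 4 * (2 ^+ k * rnorm x ^+ k) * (2 * rnorm x).
  by rewrite exprS; ring.
rewrite ler_pM2l// /r invf_div mul1r ler_pdivrMr// -mulrA -expr2//.
Qed.

(** The increments of the orbit are the values of [D] along it, each within [L] of [D x]. Hence [n *
    rnorm (D x) <= 2 * rnorm x ^+ k + n * L], and large [n] gives [rnorm (D x) <= L] near 0. The bad
    constant in [L] is reset to 2 by [ball_schwarz], so the step can be repeated; [2 <= k] keeps the
    orbit within the reach of [D_lip]. *)
Let D_step k : (2 <= k)%N ->
  (forall y, rnorm y < 1 -> rnorm (D y) <= 2 * rnorm y ^+ k) ->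
  forall y, rnorm y < 1 -> rnorm (D y) <= 2 * rnorm y ^+ k.+1.
Proof.
move=> k2 DP; have d0 : (0 : R) < 1/4 by rewrite divr_gt0.
apply: (ball_schwarz (A := 8 * 2 ^+ k) (ltr0n R 2) d0 D_diff D_le2) => x x4.
have x1 : rnorm x < 1 by lra.
set L := 8 * _ * _; have xk : rnorm x ^+ k <= rnorm x ^+ 2.
  by apply: ler_wiXn2l => //; [exact: rnorm_ge0|exact: ltW].
have nat_rnorm n y : rnorm (n%:R *: y : E) = n%:R * rnorm y.
  by rewrite rnormZ rnorm_nat.
have nD n : rnorm (T n x - x - n%:R *: D x) <= n%:R * L.
  elim: n => [|n ih]; first by rewrite subrr scale0r subr0 rnorm0 mul0r.
  have -> : T n.+1 x - x - n.+1%:R *: D x =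
      (T n x - x - n%:R *: D x) + (D (x + (T n x - x)) - D x).
    rewrite -(natr1 n) scalerDl scale1r [x + _]addrC subrK opprD addrA.
    rewrite [RHS]addrA; congr (_ - D x); rewrite [RHS]addrAC; congr (_ - _ *: D x).
    by rewrite /D [RHS]addrC addrA subrK.
  apply: (le_trans (rnormD _ _)); rewrite -(natr1 n) mulrDl mul1r; apply: lerD => //.
  apply: D_lip => //; apply: le_trans (T_sub_le n DP x1) _.
  by rewrite ler_pM2l.
apply/ler_addgt0Pr => e e0.
pose n := Num.bound (2 * rnorm x ^+ k / e).
have ne : 2 * rnorm x ^+ k < n%:R * e.
  rewrite -ltr_pdivrMr//; apply: archi_boundP.
  by rewrite divr_ge0 ?mulr_ge0 ?exprn_ge0 ?rnorm_ge0// ltW.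
have n0 : 0 < n%:R :> R.
  by have : 0 <= rnorm x ^+ k; [rewrite exprn_ge0// rnorm_ge0|nra].
rewrite -(ler_pM2l n0) -nat_rnorm.
have -> : n%:R *: D x = (T n x - x) - (T n x - x - n%:R *: D x)
    by rewrite opprB addrC subrK.
apply: (le_trans (rnormBD _ _)); have := T_sub_le n DP x1; have := nD n; lra.
Qed.

Theorem cartan_uniqueness x : rnorm x < 1 -> h x = x.
Proof.
move=> x1; apply/eqP; rewrite -subr_eq0 -/(D x); apply: contraTT x1 => DN0.
have Dk k y : rnorm y < 1 -> rnorm (D y) <= 2 * rnorm y ^+ k.+2.
  by elim: k y => [|k ih]; [exact: D_quadratic|exact: D_step].
apply/negP => x1.
have : (1 : R) <= rnorm x; last by rewrite leNgt x1.
(* Used with q = 1: a nonzero [D x] bounded by 2 |x|^(n+2) for all n would force 1 <= |x|. *)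
apply: (@ler_of_powers _ (rnorm (D x)) (2 * rnorm x ^+ 2)).
- exact: rnorm_gt0.
- exact: rnorm_ge0.
by move=> n; rewrite expr1n mulr1 -mulrA -exprD; exact: Dk.
Qed.

End CartanUniqueness.

(** * The Caratheodory metric of the unit ball *)

Section Caratheodory.
Variable R : realType.
Local Notation C := (R[i]^o).
Implicit Types E F : normedModType R[i].

Lemma diff_rnorm_le E F (g : E -> F) (K d : R) v : differentiable g 0 -> g 0 = 0 ->
  0 < d -> (forall x, rnorm x < d -> rnorm (g x) <= K * rnorm x) ->
  rnorm ('d g 0 v) <= K * rnorm v.
Proof.
move=> dg g0 d0 gK; have [->|vN0] := eqVneq v 0.
  by rewrite linear0 !rnorm0 mulr0.
have v0 := rnorm_gt0 vN0; rewrite -ler_pdivrMr//; apply/ler_addgt0Pr => e e0.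
have [d1 d10 dP] := diff_rnorm dg e0; pose t := Num.min d d1 / 2 / rnorm v.
have m0 : 0 < Num.min d d1 by rewrite lt_min d0.
have t0 : 0 < t by rewrite !divr_gt0.
have rt : rnorm (t%:C *: v) = Num.min d d1 / 2.
  by rewrite rnormZ rnorm_real gtr0_norm// /t divfK ?gt_eqF.
have [td td1] : rnorm (t%:C *: v) < d /\ rnorm (t%:C *: v) < d1.
  have : Num.min d d1 <= d /\ Num.min d d1 <= d1 by rewrite !ge_min !lexx orbT.
  by rewrite rt; lra.
have := dP _ td1; rewrite add0r g0 subr0 linearZ/= => h1; have h2 := gK _ td.
have : rnorm (t%:C *: 'd g 0 v) <= (K + e) * rnorm (t%:C *: v).
  have -> : t%:C *: 'd g 0 v = g (t%:C *: v) - (g (t%:C *: v) - t%:C *: 'd g 0 v).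
    by rewrite opprB addrC subrK.
  by apply: (le_trans (rnormBD _ _)); rewrite mulrDl lerD.
rewrite !rnormZ rnorm_real gtr0_norm// mulrCA ler_pM2l//.
by rewrite ler_pdivrMr.
Qed.

Lemma open_unit_ball (E : normedModType R[i]) : open (@unit_ball R E).
Proof.
rewrite openE => x; rewrite unit_ballE => x1.
apply/near_rnorm; exists (1 - rnorm x); first by rewrite subr_gt0.
move=> y yx; rewrite unit_ballE -(subrK x y).
by apply: (le_lt_trans (rnormD _ _)); lra.
Qed.

(** The Schwarz lemma bounds every competitor by the norm, and a norming functional, itself a
    competitor, attains it. *)
Lemma caratheodory_ball E (v : E) :
  caratheodory (@unit_ball R E) 0 v = (rnorm v)%:E.
Proof.
apply/eqP; rewrite eq_le; apply/andP; split.
  apply: ge_ereal_sup => _ [phi [[_ dphi] phi1 phi0] <-]; rewrite lee_fin.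
  have dphi' x : rnorm x < 1 -> differentiable phi x by rewrite -unit_ballE => /dphi.
  rewrite -[leRHS]mul1r; apply: (diff_rnorm_le _ _ phi0 ltr01).
    by apply: dphi'; rewrite rnorm0.
  apply: (ball_schwarz1 ltr01 phi0 dphi') => x; rewrite -unit_ballE => x1.
  by have := phi1 (phi x); rewrite unit_ballE => /(_ (ex_intro2 _ _ x x1 erefl))/ltW.
have [f [fc f1 fv]] := norming_functional v; rewrite -fv.
apply: ereal_sup_ubound; exists f; last by rewrite diff_lin.
split; last exact: linear0.
- split; first exact: open_unit_ball.
  by move=> x _; exact: linear_differentiable.
- by move=> _ [x + <-]; rewrite !unit_ballE; apply: le_lt_trans.
Qed.

Lemma caratheodory_contract E F (D1 : set E) (D2 : set F) (f : E -> F) x v :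
  holomorphic_on D1 f -> f @` D1 `<=` D2 -> D1 x ->
  (caratheodory D2 (f x) ('d f x v) <= caratheodory D1 x v)%E.
Proof.
move=> [D1o df] fD D1x; apply: ge_ereal_sup => _ [phi [[D2o dphi] phi1 phi0] <-].
have D2f y : D1 y -> D2 (f y) by move=> ?; apply: fD; exists y.
apply: ereal_sup_ubound; exists (phi \o f).
  split; last exact: phi0.
  - split=> // y D1y; exact: differentiable_comp (df _ D1y) (dphi _ (D2f _ D1y)).
  - by move=> _ [y D1y <-]; apply: phi1; exists (f y) => //; exact: D2f.
by rewrite (diff_comp (df _ D1x) (dphi _ (D2f _ D1x))).
Qed.

End Caratheodory.

(** * Invariance of the metric and left inverses of isometries *)

Section Isometries.
Variable R : realType.
Local Notation C := (R[i]^o).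

Lemma biholomorphism_diffK (E F : normedModType R[i]) (D1 : set E) (D2 :
    set F) f g x v :
  biholomorphism D1 D2 f g -> D1 x -> 'd g (f x) ('d f x v) = v.
Proof.
move=> [[[D1o df] [D2o dg]] fD _ gf _] D1x.
have D2f : D2 (f x) by apply: fD; exists x.
have near_id : \forall y \near x, y = (g \o f) y.
  by apply: filterS (open_nbhs_nbhs (conj D1o D1x)) => y /gf.
have [_ dE] := differentiable_near_eq near_id (@ex_diff _ _ _ _ _ _ _ (is_diff_id x)).
have idE := @diff_val _ _ _ _ _ _ _ (is_diff_id x).
have compE := diff_comp (df _ D1x) (dg _ D2f).
have := congr1 (fun h : E -> E => h v) (etrans (esym compE) (etrans dE idE)).
exact.
Qed.

Lemma biholomorphism_caratheodory (E F : normedModType R[i]) (D1 : set E) (D2 :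
    set F) f g x v :
  biholomorphism D1 D2 f g -> D1 x ->
  caratheodory D2 (f x) ('d f x v) = caratheodory D1 x v.
Proof.
move=> fg D1x; have [[f_hol g_hol] fD gD gf _] := fg.
have D2f : D2 (f x) by apply: fD; exists x.
apply/eqP; rewrite eq_le caratheodory_contract//=.
have := caratheodory_contract ('d f x v) g_hol gD D2f.
by rewrite gf// (biholomorphism_diffK _ fg).
Qed.

Lemma operator_norm1_le (E : normedModType R[i]) (p : {linear E -> E}) x :
  operator_norm p = 1%:E -> rnorm (p x) <= rnorm x.
Proof.
move=> p1; have [->|xN0] := eqVneq x 0; first by rewrite linear0.
have [u u1 ->] := unit_direction xN0.
have : ((rnorm (p u))%:E <= operator_norm p)%E.
  by apply: ereal_sup_ubound; exists u => //=; rewrite normE u1.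
by rewrite p1 lee_fin linearZ/= !rnormZ u1; apply: ler_wpM2l; exact: rnorm_ge0.
Qed.

(** [P] is the norm-one projection followed by the inverse of [L] on its range; injectivity of [L]
    transfers linearity, and isometry transfers the norm bound. *)
Lemma linear_left_inverse (E1 E2 : completeNormedModType R[i]) (L : {linear E1 -> E2}) :
  property_V E1 E2 -> linear_isometry L -> exists P : {linear E2 -> E1},
  [/\ forall y, rnorm (P y) <= rnorm y, forall x, P (L x) = x &
    exists G, closed_subspace G /\ direct_decomposition (range L) G].
Proof.
move=> hV Liso; have [G [p [Gc LG [pL pid _] p1]]] := hV L Liso.
have /choice[P PE] y : exists x, L x = p y by have [x _ Lx] := pL y; exists x.
have rL x : rnorm (L x) = rnorm x by rewrite /rnorm Liso.
have Linj x x' : L x = L x' -> x = x'.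
  move=> LE; apply/eqP; rewrite -subr_eq0; apply/eqP/rnorm_eq0.
  by rewrite -rL linearB LE subrr rnorm0.
have P_lin : linear P by move=> c x y; apply: Linj; rewrite linearP !PE linearP.
pose PM := GRing.isLinear.Build _ _ _ _ _ P_lin.
pose P' : {linear E2 -> E1} := HB.pack P PM.
exists P'; split => [y|x|]; last by exists G.
- by rewrite -rL PE; exact: operator_norm1_le.
- by apply: Linj; rewrite PE pid//; exists x.
Qed.

Lemma caratheodory_isometry_left_inverse (E1 E2 : completeNormedModType R[i])
    (F : E1 -> E2) : property_V E1 E2 ->
  holomorphic_on (@unit_ball R E1) F -> F @` @unit_ball R E1 `<=` @unit_ball R E2 ->
  F 0 = 0 -> caratheodory_isometry (@unit_ball R E1) (@unit_ball R E2) F 0 ->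
  exists (L : {linear E1 -> E2}) (P : {linear E2 -> E1}),
  [/\ forall x, rnorm (L x) = rnorm x, forall y, rnorm (P y) <= rnorm y,
      forall x, P (L x) = x, forall x, rnorm x < 1 -> P (F x) = x &
      exists G, closed_subspace G /\ direct_decomposition (range L) G].
Proof.
move=> hV [_ dF] FB F0 Fiso; pose L := 'd F (0 : E1).
have rL x : rnorm (L x) = rnorm x.
  by have := Fiso x; rewrite F0 !caratheodory_ball => -[].
have Liso : linear_isometry L by move=> x; rewrite !normE rL.
have [P [P1 PL LG]] := linear_left_inverse hV Liso.
exists L, P; split => // x x1.
have Pc : continuous P by apply: (@bounded_continuous _ _ _ _ 1) => y; rewrite mul1r.
have dP y : differentiable P y by exact: linear_differentiable.
have dF' y : rnorm y < 1 -> differentiable F y by rewrite -unit_ballE; exact: dF.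
have dF0 : differentiable F 0 by apply: dF'; rewrite rnorm0.
apply: (cartan_uniqueness (h := P \o F)) x1.
- by move=> y y1; exact: differentiable_comp (dF' _ y1) (dP _).
- move=> y y1; apply: le_lt_trans (P1 _) _; rewrite -unit_ballE; apply: FB.
  by exists y => //; rewrite unit_ballE.
- by rewrite /= F0 linear0.
- by move=> v; rewrite (diff_comp dF0 (dP _)) /= diff_lin// PL.
Qed.

End Isometries.

(** * The image as a graph over the range of the derivative *)

Section Submanifold.
Variables (R : realType) (E1 E2 : completeNormedModType R[i]).
Local Notation C := (R[i]^o).
Local Notation B1 := (@unit_ball R E1).
Local Notation B2 := (@unit_ball R E2).

Lemma differentiable_along_subspace (E F : normedModType R[i]) (S : set E)
    (g : E -> F) (x : E) : differentiable g x -> differentiable_along S g x.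
Proof.
move=> dg; exists ('d g x); split.
- by move=> c u v _ _; rewrite linearP.
- exact/continuous_subspaceT/diff_continuous.
move=> _ /gt0_real[e e0 ->]; have [d d0 dP] := diff_rnorm dg e0.
apply/near_rnorm; exists d => // y /dP.
by rewrite (addrC x) subrK !normE -rmorphM lecR.
Qed.

Lemma closed_range_left_inverse (L : {linear E1 -> E2}) (P : {linear E2 -> E1}) :
  continuous L -> continuous P -> (forall x, P (L x) = x) -> closed_subspace (range L).
Proof.
move=> Lc Pc PL; split.
  split; first by exists 0 => //; exact: linear0.
  by move=> c _ _ [x _ <-] [y _ <-]; exists (c *: x + y) => //; exact: linearP.
(* The range is the fixed-point set of the continuous map [L \o P], hence closed. *)
have -> : range L = (fun z => L (P z) - z) @^-1` [set 0].
  apply/seteqP; split => [_ [x _ <-]|z /= /eqP]; first by rewrite /= PL subrr.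
  by rewrite subr_eq0 => /eqP zE; exists (P z).
apply: preimage_closed => [z _|];
    last exact/accessible_closed_set1/hausdorff_accessible/norm_hausdorff.
apply: cvgB; last exact: cvg_id.
by apply: continuous_comp; [exact: Pc|exact: Lc].
Qed.

Variables (f : E1 -> E2) (u u' : E1 -> E1) (v v' : E2 -> E2).
Variables (L : {linear E1 -> E2}) (P : {linear E2 -> E1}).
Hypothesis f_hol : holomorphic_on B1 f.
Hypothesis f_ball : f @` B1 `<=` B2.
Hypothesis uu' : biholomorphism B1 B1 u u'.
Hypothesis vv' : biholomorphism B2 B2 v v'.
Hypothesis L_iso : forall x, rnorm (L x) = rnorm x.
Hypothesis P_le : forall y, rnorm (P y) <= rnorm y.
Hypothesis PL : forall x, P (L x) = x.
Hypothesis PF : forall x, rnorm x < 1 -> P (v (f (u x))) = x.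
Hypothesis L_compl : exists G, closed_subspace G /\ direct_decomposition (range L) G.

Let F x := v (f (u x)).
Let M := f @` B1.

Let L_cont : continuous L.
Proof. by apply: (@bounded_continuous _ _ _ _ 1) => y; rewrite mul1r L_iso. Qed.

Let P_cont : continuous P.
Proof. by apply: (@bounded_continuous _ _ _ _ 1) => y; rewrite mul1r. Qed.

Let u_ball x : B1 x -> B1 (u x).
Proof. by have [_ uB _ _ _] := uu' => x1; apply: uB; exists x. Qed.

Let u'_ball x : B1 x -> B1 (u' x).
Proof. by have [_ _ uB _ _] := uu' => x1; apply: uB; exists x. Qed.

Let v_ball x : B2 x -> B2 (v x).
Proof. by have [_ vB _ _ _] := vv' => x1; apply: vB; exists x. Qed.

Let v'_ball x : B2 x -> B2 (v' x).
Proof. by have [_ _ vB _ _] := vv' => x1; apply: vB; exists x. Qed.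

Let f_ball1 x : B1 x -> B2 (f x).
Proof. by move=> x1; apply: f_ball; exists x. Qed.

Let P_ball y : B2 y -> B1 (P y).
Proof. by rewrite !unit_ballE; apply: le_lt_trans. Qed.

Let u_diff x : B1 x -> differentiable u x.
Proof. by have [[[_ du] _] _ _ _ _] := uu'; exact: du. Qed.

Let v_diff x : B2 x -> differentiable v x.
Proof. by have [[[_ dv] _] _ _ _ _] := vv'; exact: dv. Qed.

Let v'_diff x : B2 x -> differentiable v' x.
Proof. by have [[_ [_ dv]] _ _ _ _] := vv'; exact: dv. Qed.

Let F_ball x : B1 x -> B2 (F x).
Proof. by move=> x1; exact/v_ball/f_ball1/u_ball. Qed.

Let F_diff x : B1 x -> differentiable F x.
Proof.
move=> x1; have dfu := differentiable_comp (u_diff x1) (f_hol.2 _ (u_ball x1)).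
exact: differentiable_comp dfu (v_diff (f_ball1 (u_ball x1))).
Qed.

Let PF1 x : B1 x -> P (F x) = x.
Proof. by rewrite unit_ballE; exact: PF. Qed.

Let P_diff y : differentiable P y.
Proof. exact: linear_differentiable. Qed.

(** Since [P] inverts [F = v \o f \o u] on the left, conjugating back by the automorphisms gives a
    left inverse of [f] itself. *)
Let g y := u (P (v y)).

Let g_ball y : B2 y -> B1 (g y).
Proof. by move=> y1; exact/u_ball/P_ball/v_ball. Qed.

Let g_diff y : B2 y -> differentiable g y.
Proof.
move=> y1; have dPv := differentiable_comp (v_diff y1) (P_diff (v y)).
exact: differentiable_comp dPv (u_diff (P_ball (v_ball y1))).
Qed.

Let vf x : B1 x -> v (f x) = F (u' x).
Proof. by have [_ _ _ _ uu'K] := uu' => x1; rewrite /F uu'K. Qed.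

Let gf x : B1 x -> g (f x) = x.
Proof.
by have [_ _ _ _ uu'K] := uu' => x1; rewrite /g vf// PF1 ?uu'K//; exact: u'_ball.
Qed.

Lemma image_holomorphic_retraction : holomorphic_retraction B2 M (f \o g).
Proof.
split.
- split; first exact: open_unit_ball.
  by move=> y y1; exact: differentiable_comp (g_diff y1) (f_hol.2 _ (g_ball y1)).
- apply/seteqP; split => [_ [y y1 <-]|_ [x x1 <-]]; first by exists (g y) => //;
    exact: g_ball.
  by exists (f x); [exact: f_ball1|rewrite /= gf].
- by move=> _ [x x1 <-]; rewrite /= gf.
Qed.

Lemma biholomorphism_onto_image : biholomorphism_onto_submanifold B1 B2 M f.
Proof.
exists g; split => //.
- by move=> x x1; apply: differentiable_continuous; exact: f_hol.2.
- move=> W W' S phi psi [_ [[[_ dphi] _] _ _ _ _] _ _] x x1 Wfx.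
  exact: differentiable_comp (f_hol.2 _ x1) (dphi _ Wfx).
- move=> W W' S phi psi [WB [[_ [_ dpsi]] _ psiW _ _] _ _] y [_ W'y].
  have B2y : B2 (psi y) by apply/WB/psiW; exists y.
  exact/differentiable_along_subspace/(differentiable_comp (dpsi _ W'y) (g_diff B2y)).
Qed.

(** Height of the graph over [L (P z)]. It lies in the kernel of [P] and depends on [z] only through
    [P z], so subtracting it is a shear, undone by adding it back. *)
Let k z := F (P z) - L (P z).
Let flatten y := y - k y.
Let unflatten z := z + k z.

Let k_diff z : B1 (P z) -> differentiable k z.
Proof.
move=> z1; apply: differentiableB;
    first exact: differentiable_comp (P_diff z) (F_diff z1).
by apply: differentiable_comp (P_diff z) _; exact: linear_differentiable.
Qed.

Let Pk z : B1 (P z) -> P (k z) = 0.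
Proof. by move=> z1; rewrite /k linearB PL PF1// subrr. Qed.

Let k_ext z w : P z = P w -> k z = k w.
Proof. by rewrite /k => ->. Qed.

Let P_flatten z : B1 (P z) -> P (flatten z) = P z.
Proof. by move=> z1; rewrite /flatten linearB Pk// subr0. Qed.

Let P_unflatten z : B1 (P z) -> P (unflatten z) = P z.
Proof. by move=> z1; rewrite /unflatten linearD Pk// addr0. Qed.

Let flattenK z : B1 (P z) -> unflatten (flatten z) = z.
Proof. by move=> z1; rewrite /unflatten (k_ext (P_flatten z1)) subrK. Qed.

Let unflattenK z : B1 (P z) -> flatten (unflatten z) = z.
Proof. by move=> z1; rewrite /flatten (k_ext (P_unflatten z1)) addrK. Qed.

Let flatten_diff z : B1 (P z) -> differentiable flatten z.
Proof. by move=> z1; apply: differentiableB; [exact: ex_diff|exact: k_diff]. Qed.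

Let unflatten_diff z : B1 (P z) -> differentiable unflatten z.
Proof. by move=> z1; apply: differentiableD; [exact: ex_diff|exact: k_diff]. Qed.

Let flattenF x : B1 x -> flatten (F x) = L x.
Proof. by move=> x1; rewrite /flatten /k PF1// opprB addrC subrK. Qed.

(** The image of [B2] under [flatten], described through the inverse so that openness follows from
    continuity; the condition on [P z] keeps the argument of [F] in its domain. *)
Let W' := [set z | B1 (P z) /\ B2 (unflatten z)].

Let openW' : open W'.
Proof.
rewrite openE => z [Pz1 z1].
have near1 : \forall w \near z, B1 (P w).
  have /(_ B1) := @P_cont z; apply.
  exact: open_nbhs_nbhs (conj (@open_unit_ball _ E1) Pz1).
have near2 : \forall w \near z, B2 (unflatten w).
  have /(_ B2) := differentiable_continuous (unflatten_diff Pz1); apply.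
  exact: open_nbhs_nbhs (conj (@open_unit_ball _ E2) z1).
by near=> w; split; near: w.
Unshelve. all: by end_near.
Qed.

Lemma image_chart : submanifold_chart B2 M B2 W' (range L) (flatten \o v) (v' \o
    unflatten).
Proof.
have [_ _ _ v'v v_v'] := vv'.
have flattenW y : B2 y -> W' (flatten y).
  by move=> y1; have Py1 := P_ball y1; split; rewrite ?P_flatten ?flattenK.
split => //.
- split.
  + split.
      split; first exact: open_unit_ball.
      move=> y y1; exact: differentiable_comp (v_diff y1) (flatten_diff (P_ball
          (v_ball y1))).
    split; first exact: openW'.
    by move=> z [Pz1 z1]; exact: differentiable_comp (unflatten_diff Pz1) (v'_diff z1).
  + by move=> _ [y y1 <-]; exact/flattenW/v_ball.
  + by move=> _ [z [_ z1] <-]; exact: v'_ball.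
  + by move=> y y1 /=; rewrite flattenK ?v'v//; exact/P_ball/v_ball.
  + by move=> z [Pz1 z1] /=; rewrite v_v'// unflattenK.
- by split; [exact: closed_range_left_inverse PL|exact: L_compl].
apply/seteqP; split => [_ [_ [[x x1 <-] _] <-]|_ [[x _ <-] [Px1 _]]] /=.
  rewrite vf//; split; last exact/flattenW/F_ball/u'_ball.
  by rewrite flattenF; [exists (u' x)|exact: u'_ball].
rewrite PL in Px1; exists (f (u x)); last by rewrite /= -/(F x) flattenF.
by split; [exists (u x) => //|]; [exact: u_ball|exact/f_ball1/u_ball].
Qed.

Lemma image_closed_direct_submanifold : closed_direct_submanifold B2 M.
Proof.
split; first exact: open_unit_ball.
  exists (closure M); first exact: closed_closure.
  apply/seteqP; split => [_ [x x1 <-]|y [y1 My]].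
    by split; [exact: f_ball1|apply: subset_closure; exists x].
  exists (g y); first exact: g_ball.
  (* A point of the closure is fixed by the retraction, by continuity and separation, and therefore
     lies in the image. *)
  have rc : {for y, continuous (f \o g)}.
    apply: differentiable_continuous.
    exact: differentiable_comp (g_diff y1) (f_hol.2 _ (g_ball y1)).
  apply: (@norm_hausdorff _ E2) => A A' nA nA'.
  have {}nA : nbhs y ((f \o g) @^-1` A) by exact: rc.
  have [z [Mz [Az A'z]]] := My _ (filterI nA nA').
  by exists z; split => //; case: Mz Az => x x1 <-; rewrite /= gf.
by move=> x [x0 x01 <-]; exists B2, W', (range L), (flatten \o v), (v' \o unflatten);
    split;
  [exact: image_chart|exact: f_ball1].
Qed.

End Submanifold.

(** * Both hypotheses reduced to a map fixing the origin *)

Lemma biholomorphism_id (R : realType) (E : normedModType R[i]) :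
  biholomorphism (@unit_ball R E) (@unit_ball R E) id id.
Proof.
split => //; try by move=> _ [x x1 <-].
by split; (split; [exact: open_unit_ball|move=> x _; exact: ex_diff]).
Qed.

(** Common form of the two cases: the automorphisms are identities when [f 0 = 0], and otherwise
    move 0 to [a] and [f a] to 0. As they preserve the Caratheodory metric, the composite inherits
    the isometry at 0. *)
Lemma image_isometric_ball (R : realType) (E1 E2 : completeNormedModType R[i])
    (f : E1 -> E2) (u u' : E1 -> E1) (v v' : E2 -> E2) :
  property_V E1 E2 -> holomorphic_on (@unit_ball R E1) f ->
  f @` @unit_ball R E1 `<=` @unit_ball R E2 ->
  biholomorphism (@unit_ball R E1) (@unit_ball R E1) u u' ->
  biholomorphism (@unit_ball R E2) (@unit_ball R E2) v v' ->
  v (f (u 0)) = 0 ->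
  caratheodory_isometry (@unit_ball R E1) (@unit_ball R E2) f (u 0) ->
  [/\ closed_direct_submanifold (@unit_ball R E2) (f @` @unit_ball R E1),
      biholomorphism_onto_submanifold (@unit_ball R E1) (@unit_ball R E2)
        (f @` @unit_ball R E1) f
    & exists r : E2 -> E2,
        holomorphic_retraction (@unit_ball R E2) (f @` @unit_ball R E1) r].
Proof.
move=> hV f_hol f_ball uu' vv' F0 f_iso.
have [[[_ du] _] uB _ _ _] := uu'; have [[[_ dv] _] vB _ _ _] := vv'.
have B0 : @unit_ball R E1 0 by rewrite unit_ballE rnorm0.
have u_ball x : unit_ball x -> unit_ball (u x) by move=> x1; apply: uB; exists x.
have f_ball1 x : unit_ball x -> unit_ball (f x) by move=> x1; apply: f_ball; exists x.
have v_ball y : unit_ball y -> unit_ball (v y) by move=> y1; apply: vB; exists y.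
have dfu x : unit_ball x -> differentiable (f \o u) x.
  by move=> x1; exact: differentiable_comp (du _ x1) (f_hol.2 _ (u_ball _ x1)).
have F_iso : caratheodory_isometry (@unit_ball R E1) (@unit_ball R E2) (v \o (f \o u))
    0.
  move=> x; rewrite (diff_comp (dfu _ B0) (dv _ (f_ball1 _ (u_ball _ B0)))) /=.
  rewrite (biholomorphism_caratheodory _ vv' (f_ball1 _ (u_ball _ B0))).
  rewrite (diff_comp (du _ B0) (f_hol.2 _ (u_ball _ B0))) /= f_iso.
  exact: biholomorphism_caratheodory uu' B0.
have [|_ [x x1 <-]||L [P [rL P1 PL PF LG]]] := caratheodory_isometry_left_inverse hV _
    _ _ F_iso.
- split; first exact: open_unit_ball.
  by move=> x x1; exact: differentiable_comp (dfu _ x1) (dv _ (f_ball1 _ (u_ball _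
      x1))).
- exact/v_ball/f_ball1/u_ball.
- exact: F0.
split.
- exact: (image_closed_direct_submanifold f_hol f_ball uu' vv' rL P1 PL PF LG).
- exact: (biholomorphism_onto_image f_hol uu' vv' P1 PF).
- by eexists; exact: (image_holomorphic_retraction f_hol f_ball uu' vv' P1 PF).
Qed.

Theorem theorem2 (R : realType) (E1 E2 : completeNormedModType R[i])
    (hV : property_V E1 E2) (f : E1 -> E2)
    (f_hol : holomorphic_on (@unit_ball R E1) f)
    (f_ball : f @` @unit_ball R E1 `<=` @unit_ball R E2)
    (f_iso :
      (f 0 = 0 /\
       caratheodory_isometry (@unit_ball R E1) (@unit_ball R E2) f 0) \/
      [/\ homogeneous (@unit_ball R E1), homogeneous (@unit_ball R E2)
        & exists a : E1, @unit_ball R E1 a /\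
            caratheodory_isometry (@unit_ball R E1) (@unit_ball R E2) f a]) :
  [/\ closed_direct_submanifold (@unit_ball R E2) (f @` @unit_ball R E1),
      biholomorphism_onto_submanifold (@unit_ball R E1) (@unit_ball R E2)
        (f @` @unit_ball R E1) f
    & exists r : E2 -> E2,
        holomorphic_retraction (@unit_ball R E2) (f @` @unit_ball R E1) r].
Proof.
case: f_iso => [[f0 f_iso]|[hom1 hom2 [a [a1 f_iso]]]].
  exact: (image_isometric_ball hV f_hol f_ball (@biholomorphism_id _ E1)
    (@biholomorphism_id _ E2) f0 f_iso).
have B10 : @unit_ball R E1 0 by rewrite unit_ballE rnorm0.
have B20 : @unit_ball R E2 0 by rewrite unit_ballE rnorm0.
have B2fa : unit_ball (f a) by apply: f_ball; exists a.
have [u [u' [uu' ua]]] := hom1 _ _ B10 a1; have [v [v' [vv' v0]]] := hom2 _ _ B2fa B20.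
apply: (image_isometric_ball hV f_hol f_ball uu' vv'); by rewrite ua.
Qed.
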